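(* Let $X, X_1, X_2, \ldots$ be independent identically distributed non-degenerate real-valued random variables and $S_n = X_1 + \cdots + X_n$, $n \ge 1$. Then $$\limsup_{n \rightarrow \infty} \left| \frac{S_{n}}{\sqrt{n}} \right|^{(\log \log n)^{-1}} \leq 1 \quad \text{almost surely}$$ if and only if $$\mathbb{E}X = 0 \quad\text{and}\quad \inf \left\{b > 0:~ \mathbb{E} \left(\frac{X^{2}}{(L|X|)^{2b}} \right) < \infty \right\} = 0.$$ Moreover, if either of these two equivalent conditions holds, then $$\limsup_{n \rightarrow \infty} \left| \frac{S_{n}}{\sqrt{n}} \right|^{(\log \log n)^{-1}} = 1 \quad \text{almost surely}.$$
   Context: $\log$ is the natural logarithm and $Lx = \log(\max(e, x))$ for $x \ge 0$. The quantity $|\cdot|^{(\log\log n)^{-1}}$ is considered for $n \ge 3$. The infimum of the empty set is $+\infty$. Non-degenerate means not almost surely equal to a constant. The condition $\mathbb{E}X = 0$ includes that $\mathbb{E}X$ exists. *)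

(* Defs.v *)
From HB Require Import structures.
From mathcomp Require Import all_boot all_order all_algebra finmap.
From mathcomp Require Import all_classical all_reals all_analysis.

Set Implicit Arguments.
Unset Strict Implicit.
Unset Printing Implicit Defensive.

Import Order.TTheory GRing.Theory Num.Theory.
Import numFieldNormedType.Exports.

Local Open Scope classical_set_scope.
Local Open Scope ring_scope.

Definition independent_RVs (d : measure_display) (T : measurableType d)
    (R : realType) (P : probability T R) (I : choiceType)
    (X : I -> {RV P >-> R}) : Prop :=
  forall (J : {fset I}) (B : I -> set R),
    (forall i, i \in J -> measurable (B i)) ->
    P (\bigcap_(i in [set` J]) (X i @^-1` B i)) =
    (\prod_(i <- J) P (X i @^-1` B i))%E.

Definition identically_distributed (d : measure_display) (T : measurableType d)
    (R : realType) (P : probability T R) (I : Type)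
    (X : I -> {RV P >-> R}) : Prop :=
  forall (i j : I) (B : set R), measurable B ->
    distribution P (X i) B = distribution P (X j) B.

Definition iid (d : measure_display) (T : measurableType d)
    (R : realType) (P : probability T R) (I : choiceType)
    (X : I -> {RV P >-> R}) : Prop :=
  independent_RVs X /\ identically_distributed X.

Definition non_degenerate (d : measure_display) (T : measurableType d)
    (R : realType) (P : probability T R) (X : {RV P >-> R}) : Prop :=
  ~ exists c : R, {ae P, forall w, X w = c}.

(* The family is indexed from 0, and [X 0] is the generic copy that does not
   enter the sums: S_n = X_1 + ... + X_n. *)
Definition partial_sum (d : measure_display) (T : measurableType d)
    (R : realType) (P : probability T R) (X : nat -> {RV P >-> R})
    (n : nat) (w : T) : R :=
  \sum_(1 <= i < n.+1) X i w.

Definition Llog (R : realType) (x : R) : R := ln (Num.max (expR 1) x).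

(* For n < 3, log log n is undefined or negative; these finitely many terms do
   not affect the limsup. *)
Definition limsup_norm_sum (d : measure_display) (T : measurableType d)
    (R : realType) (P : probability T R) (X : nat -> {RV P >-> R})
    (w : T) : \bar R :=
  limn_esup (fun n : nat =>
    (`|partial_sum X n w / Num.sqrt n%:R| `^ (ln (ln n%:R))^-1)%:E).

(* Main.v *)
Require Import Defs.
From HB Require Import structures.
From mathcomp Require Import all_boot all_order all_algebra finmap.
From mathcomp Require Import all_classical all_reals all_analysis.
From mathcomp Require Import measurable_realfun.
From mathcomp Require Import ring lra.

Set Implicit Arguments.
Unset Strict Implicit.
Unset Printing Implicit Defensive.

Import Order.TTheory GRing.Theory Num.Theory.
Import numFieldNormedType.Exports.

Local Open Scope classical_set_scope.
Local Open Scope ring_scope.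

(** Taking the power [1 / log log n] erases constants and turns [(log n)^delta]
    into [e^delta]. Hence the limsup is at most 1 if and only if, for every
    [delta > 0], eventually [|S_n| <= sqrt n (log n)^delta]
    ([limsup_norm_sum_le1P]), and it is at least 1 as soon as [|S_n|] exceeds a
    fixed multiple of [sqrt n] infinitely often ([limsup_norm_sum_ge1]).

    Lower bound. For a non-degenerate [X], the modulus of the characteristic
    function satisfies [|phi(s)|^2 <= 1 - k s^2] near 0, so for a sum of [n] terms
    it is bounded away from 1 at [s = 1 / sqrt n]. This forces such a sum to
    exceed [tau sqrt n] with probability at least [tau / 2]
    ([block_sum_spread]); applied to the independent dyadic blocks, the second
    Borel-Cantelli lemma yields [partial_sum_frequently_large].

    From the moments to the growth. Write [phi b x = x^2 / (L |x|)^(2b)] and fix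
    [b < delta] with [E (phi b X)] finite. The moment says that the
    probabilities of [phi b (X n) > n] are summable, so eventually
    [|X n| <= sqrt n (log n)^b]. At the scale [n = 2^k] one may thus truncate at
    [c = sqrt n (log n)^b]. Truncation shifts the mean by
    at most [(L c)^(2b) / c] times [E (phi b X)], and the second moment of the
    truncated variable is at most [(L c)^(2b) E (phi b X)]; with the parameter
    [1 / (2c)] the exponential moments of all the centred truncated sums stay
    bounded, and Chernoff's bound at [sqrt n (log n)^g], [b < g < delta], is of
    order [exp (- k^(g - b) / 2)]. Ottaviani's inequality extends this to the
    maximum over the scale, and the first Borel-Cantelli lemma over [k] gives
    [growth_bound]: eventually [|S_n - n mu| <= sqrt n (log n)^delta].

    From the growth to the moments. Since [X n] is a difference of consecutive
    sums, eventually [|X n| <= 2 sqrt n (log n)^delta], and the second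
    Borel-Cantelli lemma makes [E (phi b X)] finite for every [b > delta].
    In particular [X] is integrable, and comparing [growth_bound] with the
    assumed growth of [S_n] shows that its mean is 0. *)

(** * Level sets of measurable functions *)

Section LevelSets.
Context d (T : measurableType d) (R : realType).
Variable f : T -> R.
Hypothesis mf : measurable_fun setT f.

Let measurable_preimage (B : set R) : measurable B -> measurable (f @^-1` B).
Proof. by move=> mB; rewrite -[X in measurable X]setTI; exact: mf. Qed.

Lemma measurable_le_level (x : R) : measurable [set w | f w <= x].
Proof.
rewrite (_ : [set _ | _] = f @^-1` `]-oo, x]); first exact: measurable_preimage.
by apply/seteqP; split=> w /=; rewrite in_itv.
Qed.

Lemma measurable_ge_level (x : R) : measurable [set w | x <= f w].
Proof.
rewrite (_ : [set _ | _] = f @^-1` `[x, +oo[); first exact: measurable_preimage.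
by apply/seteqP; split=> w /=; rewrite in_itv/= andbT.
Qed.

Lemma measurable_gt_level (x : R) : measurable [set w | x < f w].
Proof.
rewrite (_ : [set _ | _] = f @^-1` `]x, +oo[); first exact: measurable_preimage.
by apply/seteqP; split=> w /=; rewrite in_itv/= andbT.
Qed.

Lemma measurable_band (u v : R) : measurable [set w | u <= f w <= v].
Proof.
rewrite (_ : [set _ | _] = f @^-1` `[u, v]); first exact: measurable_preimage.
by apply/seteqP; split=> w /=; rewrite in_itv.
Qed.

End LevelSets.

(** * Independence of disjoint groups of variables *)

Section Independence.
Context d (T : measurableType d) (R : realType) (P : probability T R).

Definition indep_classes (G H : set (set T)) : Prop :=
  forall A B, G A -> H B -> P (A `&` B) = (P A * P B)%E.

Let indep_sigma_left (G : set (set T)) (B : set T) :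
  setI_closed G -> G `<=` measurable -> measurable B ->
  (forall A, G A -> P (A `&` B) = (P A * P B)%E) ->
  forall A, <<s G >> A -> measurable A /\ P (A `&` B) = (P A * P B)%E.
Proof.
move=> GI Gm mB GB.
pose H := [set A | measurable A /\ P (A `&` B) = (P A * P B)%E].
apply: (@lambda_system_subset _ G GI setT H) => //.
- apply/dynkin_lambda_system; split.
  + by split=> //; rewrite setTI probability_setT mul1e.
  + move=> A [mA PAB]; split; first exact: measurableC.
    rewrite setIC -setDE measureD//; last first.
      by rewrite ltey_eq fin_num_measure.
    rewrite setIC in PAB; rewrite probability_setC// [X in (_ - X)%E]PAB.
    by rewrite muleBl ?mul1e// ?fin_num_measure//.
  + move=> F tF HF; split; first by apply: bigcup_measurable => i _; apply: (HF i).1.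
    rewrite setI_bigcupl measure_bigcup//=; last 2 first.
    * by move=> i _; apply: measurableI => //; exact: (HF i).1.
    * apply/trivIsetP => i j _ _ ij.
      by rewrite setIACA (trivIsetP.1 tF)// set0I.
    rewrite measure_bigcup//=; last by move=> i _; exact: (HF i).1.
    rewrite -(fineK (fin_num_measure P B mB)) muleC -nneseriesZl//.
    by apply: eq_eseriesr => i _; rewrite (HF i).2 muleC fineK// fin_num_measure.
- by move=> A GA; split; [exact: Gm|exact: GB].
Qed.

(** For a fixed event on one side, the events satisfying the product rule form
    a Dynkin system; the pi-lambda theorem is therefore applied once per side. *)
Lemma indep_classes_sigma (G H : set (set T)) :
  setI_closed G -> setI_closed H -> G `<=` measurable -> H `<=` measurable ->
  indep_classes G H -> indep_classes <<s G >> <<s H >>.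
Proof.
move=> GI HI Gm Hm GH.
have sGH B : H B -> forall A, <<s G >> A ->
    measurable A /\ P (A `&` B) = (P A * P B)%E.
  by move=> HB; apply: indep_sigma_left => // [|A GA]; [exact: Hm|exact: GH].
move=> A B sGA sHB; rewrite setIC muleC.
have mA : measurable A.
  by move: A sGA; apply: smallest_sub => //; exact: sigma_algebra_measurable.
apply: (indep_sigma_left HI Hm mA _ sHB).2 => C HC.
by rewrite setIC (sGH _ HC _ sGA).2 muleC.
Qed.

Variable X : nat -> {RV P >-> R}.

(** These finite-dimensional events form a pi-system on which the independence
    of the family [X] is literally the product rule. *)
Definition cylinders (D : set nat) : set (set T) :=
  [set A | exists (J : {fset nat}) (B : nat -> set R),
    [/\ [set` J] `<=` D, forall i, measurable (B i) &
        A = \bigcap_(i in [set` J]) X i @^-1` B i]].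

Lemma cylinders_measurable D : cylinders D `<=` measurable.
Proof.
move=> _ [J [B [_ mB ->]]]; apply: bigcap_measurableType => i _.
by rewrite -[X in measurable X]setTI; exact: measurable_funP.
Qed.

Lemma cylinders_setI D : setI_closed (cylinders D).
Proof.
move=> _ _ [J [B [JD mB ->]]] [K [C [KD mC ->]]].
exists (J `|` K)%fset,
  (fun i => (if i \in J then B i else setT) `&` (if i \in K then C i else setT)).
split.
- by move=> i /=; rewrite in_fsetU => /orP[/JD|/KD].
- by move=> i; apply: measurableI; case: ifP.
- apply/seteqP; split=> [w [Bw Cw] i _|w h].
    by split; case: ifP => // iJ; [exact: Bw|exact: Cw].
  split=> i iJ; have := h i.
  + by rewrite /= in_fsetU (_ : i \in J)// => /(_ isT) [].
  + by rewrite /= in_fsetU (_ : i \in K)// orbT => /(_ isT) [].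
Qed.

Lemma cylinders_sub D D' : D `<=` D' -> cylinders D `<=` cylinders D'.
Proof.
move=> DD' _ [J [B [JD mB ->]]]; exists J, B; split=> //.
exact: subset_trans DD'.
Qed.

(** The sigma-algebra generated by the variables [X i], [i] in [D]. *)
Definition history (D : set nat) : set (set T) := <<s cylinders D >>.

Lemma history_measurable D A : history D A -> measurable A.
Proof.
move: A; apply: smallest_sub; first exact: sigma_algebra_measurable.
exact: cylinders_measurable.
Qed.

Lemma history_sub D D' : D `<=` D' -> history D `<=` history D'.
Proof. by move=> DD'; apply: sub_smallest2r; 
  [exact: smallest_sigma_algebra|exact: cylinders_sub].
Qed.

Lemma history_setC D A : history D A -> history D (~` A).
Proof.
move=> hA; rewrite -setTD.
by have [_ + _] := smallest_sigma_algebra setT (cylinders D); apply.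
Qed.

Lemma history_bigcup D (F : nat -> set T) :
  (forall i, history D (F i)) -> history D (\bigcup_i F i).
Proof.
by move=> hF; have [_ _ +] := smallest_sigma_algebra setT (cylinders D); apply.
Qed.

Lemma history_set0 D : history D set0.
Proof. by have [+ _ _] := smallest_sigma_algebra setT (cylinders D). Qed.

Lemma history_setI D A B : history D A -> history D B -> history D (A `&` B).
Proof.
move=> hA hB; rewrite -[A `&` B]setCK setCI; apply: history_setC.
rewrite -bigcup2E; apply: history_bigcup => -[|[|i]] /=; try exact: history_setC.
exact: history_set0.
Qed.

Lemma history_preimage D i B : D i -> measurable B -> history D (X i @^-1` B).
Proof.
move=> Di mB; apply: sub_sigma_algebra.
exists [fset i]%fset, (fun=> B); split=> //.
- by move=> j /=; rewrite inE => /eqP ->.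
- by rewrite set_fset1 bigcap_set1.
Qed.

Lemma indep_history D D' : independent_RVs X -> [disjoint D & D'] ->
  indep_classes (history D) (history D').
Proof.
move=> indX DD'; apply: indep_classes_sigma; try exact: cylinders_setI;
  try exact: cylinders_measurable.
move=> _ _ [J [B [JD mB ->]]] [K [C [KD mC ->]]].
have JK i : i \in J -> i \in K -> False.
  move=> /JD Di /KD D'i; move/disj_setPS : DD' => /(_ i); apply; split=> //.
rewrite !indX//.
have -> : \bigcap_(i in [set` J]) X i @^-1` B i `&`
    \bigcap_(i in [set` K]) X i @^-1` C i =
    \bigcap_(i in [set` (J `|` K)%fset]) X i @^-1` (if i \in J then B i else C i).
  apply/seteqP; split=> [w [Bw Cw] i /=|w h].
    rewrite in_fsetU; have [iJ _|_ /= iK] := boolP (i \in J); first exact: Bw.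
    exact: Cw.
  split=> i /= iJ; have := h i; rewrite /= in_fsetU.
  + by rewrite iJ => /(_ isT).
  + rewrite iJ orbT; case: ifPn => [iJ'|_ /(_ isT)//].
    by case: (JK i).
rewrite indX//; last by move=> i _; case: ifP.
rewrite (big_fsetID _ (fun i => i \in J)) /=; congr (_ * _)%E.
- rewrite (_ : [fset x | x in _ & _]%fset = J); last first.
    apply/fsetP => i; rewrite !inE/=; case: (i \in J) => //=.
    by rewrite andbF.
  by rewrite !big_seq; apply: eq_bigr => i ->.
- rewrite (_ : [fset x | x in _ & _]%fset = K); last first.
    apply/fsetP => i; rewrite !inE/=; have [iJ|_] := boolP (i \in J) => /=.
      by apply/esym/negbTE/negP => iK; apply: (JK i).
    by rewrite andbT.
  rewrite !big_seq; apply: eq_bigr => i iK.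
  by case: ifP => // iJ; case: (JK i).
Qed.

(** Measurability with respect to [history D], phrased through preimages so
    that all functions keep the type [T -> R]. *)
Definition adapted (D : set nat) (f : T -> R) : Prop :=
  forall B, measurable B -> history D (f @^-1` B).

Lemma adaptedP D f :
  adapted D f <->
  measurable_fun setT (f : g_sigma_algebraType (cylinders D) -> R).
Proof.
split=> [af _ B mB|mf B mB]; first by rewrite setTI; exact: af.
by rewrite -[_ @^-1` _]setTI; exact: mf.
Qed.

End Independence.

(** * Expectation of products *)

Section Expectation.
Context d (T : measurableType d) (R : realType) (P : probability T R).

Lemma bounded_integrable (f : T -> R) (M : R) :
  measurable_fun setT f -> (forall w, `|f w| <= M) ->
  P.-integrable setT (EFin \o f).
Proof.
move=> mf fM; apply: (@le_integrable _ _ _ P setT measurableT _ (EFin \o cst M)).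
- exact/measurable_EFinP.
- move=> w _ /=; rewrite lee_fin (le_trans (fM w))// ger0_norm//.
  exact: le_trans (fM w).
- by apply: finite_measure_integrable_cst.
Qed.

(** Independence turns the joint law into a product measure, so Fubini's
    theorem splits the expectation of the product. *)
Lemma Rintegral_indep_mul (U V : T -> R) (M N : R) :
  measurable_fun setT U -> measurable_fun setT V ->
  (forall A B, measurable A -> measurable B ->
    P (U @^-1` A `&` V @^-1` B) = (P (U @^-1` A) * P (V @^-1` B))%E) ->
  (forall w, `|U w| <= M) -> (forall w, `|V w| <= N) ->
  \int[P]_w (U w * V w) = \int[P]_w U w * \int[P]_w V w.
Proof.
move=> mU mV indUV UM VN.
have mW : measurable_fun setT (fun w => (U w, V w)) by exact: measurable_fun_pair.
pose rU : {RV P >-> R} := mfun_Sub (mem_set mU).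
pose rV : {RV P >-> R} := mfun_Sub (mem_set mV).
pose rW : {RV P >-> (R * R)%type} := mfun_Sub (mem_set mW).
pose mu1 := distribution P rU; pose mu2 := distribution P rV.
pose f (z : R * R) := (z.1 * z.2)%:E.
have mf : measurable_fun setT f.
  by apply/measurable_EFinP; apply: measurable_funM;
    [exact: measurable_fst|exact: measurable_snd].
have iU : P.-integrable setT (EFin \o U) by exact: bounded_integrable UM.
have iV : P.-integrable setT (EFin \o V) by exact: bounded_integrable VN.
have iUV : P.-integrable setT (EFin \o (fun w => U w * V w)).
  apply: (@bounded_integrable _ (M * N)); first exact: measurable_funM.
  by move=> w; rewrite normrM ler_pM.
have joint A : measurable A -> (mu1 \x mu2)%E A = distribution P rW A.
  apply: (@product_measure_unique _ _ _ _ _ mu1 mu2 (distribution P rW)) => B C mB mC.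
  exact: indUV.
have eqint (g : R * R -> \bar R) :
    (\int[distribution P rW]_z g z = \int[(mu1 \x mu2)%E]_z g z)%E.
  by apply: eq_measure_integral => A mA _; exact: (esym (joint A mA)).
have iW : (distribution P rW).-integrable setT f.
  by apply: integrable_pushforward => //; rewrite preimage_setT.
have i12 : (mu1 \x mu2)%E.-integrable setT f.
  by apply/integrableP; split=> //; rewrite -eqint; have /integrableP[] := iW.
have iid1 (r : {RV P >-> R}) : P.-integrable setT (EFin \o r) ->
    (distribution P r).-integrable setT EFin.
  move=> ir; apply: integrable_pushforward => //.
have -> : \int[P]_w (U w * V w) = fine (\int[distribution P rW]_z f z)%E.
  by rewrite integral_distribution.
rewrite eqint -integral12_prod_meas1// /fubini_F.
under eq_integral => x _.
  rewrite (_ : (\int[mu2]_y f (x, y) = x%:E * \int[mu2]_y (y%:E))%E); last first.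
    by rewrite -integralZl//; exact: iid1.
  over.
have fV : (\int[mu2]_y y%:E)%E = (\int[P]_w V w)%:E.
  by rewrite integral_distribution//= /Rintegral fineK// integrable_fin_num.
rewrite fV; under eq_integral do rewrite muleC.
rewrite integralZl//; last exact: iid1.
rewrite (_ : (\int[mu1]_y y%:E)%E = (\int[P]_w U w)%:E).
  by rewrite -EFinM /= mulrC.
by rewrite integral_distribution//= /Rintegral fineK// integrable_fin_num.
Qed.

End Expectation.

(** * Borel-Cantelli lemmas *)

Section BorelCantelli.
Context d (T : measurableType d) (R : realType) (P : probability T R).

Lemma borel_cantelli_first (A : nat -> set T) :
  (forall k, measurable (A k)) -> (\sum_(k <oo) P (A k) < +oo)%E ->
  {ae P, forall w, \forall k \near \oo, ~ A k w}.
Proof.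
move=> mA sA; have PA := lim_sup_set_cvg0 mA sA.
exists (lim_sup_set A); split=> //.
  apply: bigcapT_measurable => n; apply: bigcup_measurable => k _; exact: mA.
move=> w /= nw n _ /=; apply: contrapT => nA; apply: nw; exists n => // k /= nk Ak.
by apply: nA; exists k.
Qed.

Variable X : nat -> {RV P >-> R}.
Hypothesis indX : independent_RVs X.

Let prod_compl (D : nat -> set nat) (A : nat -> set T) :
  trivIset setT D -> (forall k, history X (D k) (A k)) -> forall n m,
  let C := \bigcap_(k in [set k | n <= k < n + m]%N) ~` A k in
  history X (\bigcup_(k in [set k | (k < n + m)%N]) D k) C /\
  P C = (\prod_(n <= k < n + m) (1 - P (A k)))%E.
Proof.
move=> tD hA n; elim=> [|m [IH1 IH2]] /=.
  rewrite addn0 big_geq// (_ : \bigcap_(_ in _) _ = setT); last first.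
    by apply/seteqP; split=> // w _ k /= /andP[nk /(leq_ltn_trans nk)]; rewrite ltnn.
  split; last exact: probability_setT.
  by rewrite -setC0; apply: history_setC; exact: history_set0.
have -> : \bigcap_(k in [set k | n <= k < n + m.+1]%N) ~` A k =
   \bigcap_(k in [set k | n <= k < n + m]%N) ~` A k `&` ~` A (n + m)%N.
  apply/seteqP; split=> [w h|w [h hm] k /=].
    split=> [k /= /andP[nk km]|]; apply: h => /=.
      by rewrite nk addnS ltnS ltnW.
    by rewrite leq_addr addnS ltnS leqnn.
  rewrite addnS ltnS => /andP[nk]; rewrite leq_eqVlt => /predU1P[->//|km].
  by apply: h; rewrite /= nk.
have hm : history X (D (n + m)%N) (~` A (n + m)%N) by apply: history_setC.
split.
  apply: history_setI.
  - apply: history_sub IH1 => i [k /= km Dk]; exists k => //=.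
    by rewrite addnS ltnS ltnW.
  - apply: history_sub hm => i Di; exists (n + m)%N => //=.
    by rewrite addnS.
rewrite addnS big_nat_recr ?leq_addr//= -IH2.
rewrite (indep_history indX _ IH1 hm) ?probability_setC//.
  exact: history_measurable (hA _).
apply/disj_setPS => i [[k /= km Dk] Dm].
have /trivIsetP /(_ k (n + m)%N I I) := tD.
rewrite ltn_eqF// => /(_ isT) /seteqP[+ _] => /(_ i); exact.
Qed.

(** Second Borel-Cantelli lemma: by independence and [1 - p <= expR (- p)], the
    probability that none of the events from [n] on occurs is at most the
    exponential of minus a divergent sum. *)
Lemma borel_cantelli_second (D : nat -> set nat) (A : nat -> set T) :
  trivIset setT D -> (forall k, history X (D k) (A k)) ->
  (\sum_(k <oo) P (A k) = +oo)%E ->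
  {ae P, forall w, forall n, exists2 k, (n <= k)%N & A k w}.
Proof.
move=> tD hA sA.
have mA k : measurable (A k) by exact: history_measurable (hA k).
suff tail0 : forall n, P (\bigcap_(k in [set k | (n <= k)%N]) ~` A k) = 0%E.
  apply: ae_foralln => n.
  exists (\bigcap_(k in [set k | (n <= k)%N]) ~` A k); split; last 2 first.
    exact: tail0.
    by move=> w /= nw k /= nk Ak; apply: nw; exists k.
  by apply: bigcap_measurableType => k _; exact: measurableC.
move=> n; set C := \bigcap_(_ in _) _.
have mC : measurable C by apply: bigcap_measurableType => k _; exact: measurableC.
apply: contrapT => /eqP C0.
have fP B : measurable B -> P B \is a fin_num by exact: fin_num_measure.
pose x := fine (P C); pose p k := fine (P (A k)).
have x0 : 0 < x.
  by rewrite fine_gt0// lt0e C0 measure_ge0/= ltey_eq fP.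
have pk k : P (A k) = (p k)%:E by rewrite fineK// fP.
have p1 k : p k <= 1 by rewrite -lee_fin -pk probability_le1.
have xle m : x <= expR (- \sum_(n <= k < n + m) p k).
  rewrite -lee_fin /x fineK ?fP//.
  have [hC PC] := prod_compl tD hA n m.
  apply: (@le_trans _ _ (P (\bigcap_(k in [set k | n <= k < n + m]%N) ~` A k))).
    apply: le_measure; rewrite ?inE//.
      by apply: bigcap_measurableType => k _; exact: measurableC.
    by move=> w Cw k /= /andP[nk _]; exact: Cw.
  rewrite PC -sumrN expR_sum.
  rewrite (eq_bigr (fun k => (1 - p k)%:E)); last by move=> k _; rewrite EFinB -pk.
  rewrite prodEFin lee_fin; apply: ler_prod => k _.
  by rewrite subr_ge0 p1/= expR_ge1Dx.
have : (\sum_(k <oo) P (A k) <= (n%:R - ln x)%:E)%E.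
  apply: lime_le; first by apply: is_cvg_nneseries => k _ _; exact: measure_ge0.
  near=> m.
  have nm : (n <= m)%N by near: m; exists n.
  rewrite (eq_bigr (fun k => (p k)%:E)); last by move=> k _; rewrite -pk.
  rewrite sumEFin lee_fin (big_cat_nat (leq0n n) nm)/= lerD//.
    apply: le_trans (ler_sum (G := fun=> 1) _ _) _ => //.
    by rewrite sumr_const_nat subn0.
  rewrite lerNr -[leRHS]expRK ler_ln ?posrE ?expR_gt0//.
  by have := xle (m - n)%N; rewrite subnKC.
by rewrite sA.
Unshelve. all: by end_near. Qed.

End BorelCantelli.

(** * Sums over blocks and Ottaviani's inequality *)

Section BlockSums.
Context d (T : measurableType d) (R : realType) (P : probability T R).
Variable X : nat -> {RV P >-> R}.

Lemma adapted_measurable (D : set nat) (f : T -> R) :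
  adapted X D f -> measurable_fun setT f.
Proof. by move=> af _ B mB; rewrite setTI; exact: history_measurable (af B mB). Qed.

Lemma adapted_comp (D : set nat) (f : T -> R) (g : R -> R) :
  measurable_fun setT g -> adapted X D f -> adapted X D (g \o f).
Proof.
move=> mg af B mB; rewrite comp_preimage; apply: af.
by rewrite -[X in measurable X]setTI; exact: mg.
Qed.

Lemma adapted_gt (D : set nat) (f : T -> R) (t : R) :
  adapted X D f -> history X D [set w | t < f w].
Proof.
move=> af; have -> : [set w | t < f w] = f @^-1` `]t, +oo[.
  by apply/seteqP; split=> w /=; rewrite in_itv/= andbT.
by apply: af; exact: measurable_itv.
Qed.

Lemma adapted_le (D : set nat) (f : T -> R) (t : R) :
  adapted X D f -> history X D [set w | f w <= t].
Proof.
move=> af; have -> : [set w | f w <= t] = ~` [set w | t < f w].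
  by apply/seteqP; split=> w /=; rewrite ltNge; [move=> ->|move/negP; rewrite negbK].
by apply: history_setC; exact: adapted_gt.
Qed.

Definition block_sum (h : R -> R) (a b : nat) (w : T) : R :=
  \sum_(a <= i < b) h (X i w).

Definition block (a b : nat) : set nat := [set i | (a <= i < b)%N].

Lemma adapted_block_sum (h : R -> R) (a b : nat) :
  measurable_fun setT h -> adapted X (block a b) (block_sum h a b).
Proof.
move=> mh; apply/adaptedP.
rewrite (_ : block_sum h a b = 
  fun w => \sum_(i <- [seq i <- index_iota a b | (a <= i < b)%N])
   (if (a <= i < b)%N then h (X i w) else 0)); last first.
  apply/funext => w; rewrite /block_sum big_filter big_nat.
  by apply: eq_bigr => i ->.
apply: measurable_sum => i.
case: (boolP (a <= i < b)%N) => [ab|_]; last exact: measurable_cst.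
apply: (@measurableT_comp _ _ _ _ _ _ h) => //.
by apply/adaptedP => B mB; exact: history_preimage.
Qed.

Lemma block_sum_recr (h : R -> R) (a b : nat) : (a <= b)%N ->
  block_sum h a b.+1 = (fun w => block_sum h a b w + h (X b w)).
Proof. by move=> ab; apply/funext => w; rewrite /block_sum big_nat_recr. Qed.

Lemma block_sum_cat (h : R -> R) (a b c : nat) w : (a <= b)%N -> (b <= c)%N ->
  block_sum h a c w = block_sum h a b w + block_sum h b c w.
Proof. by move=> ab bc; rewrite /block_sum (big_cat_nat ab bc). Qed.

Lemma block_sum1 (h : R -> R) (a : nat) : block_sum h a a.+1 = h \o X a.
Proof. by apply/funext => w; rewrite /block_sum big_nat1. Qed.

Hypothesis indX : independent_RVs X.

Lemma Rintegral_mul_adapted (D D' : set nat) (U V : T -> R) (M N : R) :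
  [disjoint D & D'] -> adapted X D U -> adapted X D' V ->
  (forall w, `|U w| <= M) -> (forall w, `|V w| <= N) ->
  \int[P]_w (U w * V w) = \int[P]_w U w * \int[P]_w V w.
Proof.
move=> DD' aU aV.
apply: (Rintegral_indep_mul (adapted_measurable aU) (adapted_measurable aV)).
move=> A B mA mB; apply: (indep_history indX DD'); [exact: aU|exact: aV].
Qed.

Lemma disjoint_blocks (a b c e : nat) : (b <= c)%N ->
  [disjoint block a b & block c e].
Proof.
move=> bc; apply/disj_setPS => i /= [/andP[_ ib] /andP[ci _]].
by have := leq_trans ib (leq_trans bc ci); rewrite ltnn.
Qed.

(** Ottaviani's inequality: when the partial sums first leave [-2t, 2t] at time
    k, the independent remaining increment stays below t with probability at
    least 1/2, which forces the final sum to exceed t. *)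
Lemma ottaviani (h : R -> R) (a n : nat) (t : R) : measurable_fun setT h ->
  (forall k, (k <= n)%N ->
    (P [set w | (t < `|block_sum h (a + k) (a + n) w|)%R] <= (2^-1)%:E)%E) ->
  (P [set w | exists2 k, (k <= n)%N & (2 * t < `|block_sum h a (a + k) w|)%R]
    <= 2%:E * P [set w | (t < `|block_sum h a (a + n) w|)%R])%E.
Proof.
move=> mh half.
have aN c e : adapted X (block c e) (fun w => `|block_sum h c e w|).
  apply: (@adapted_comp _ _ (fun x => `|x|)); first exact: normr_measurable.
  exact: adapted_block_sum.
have mgt c e u : measurable [set w | u < `|block_sum h c e w|].
  by apply: history_measurable; apply: adapted_gt; exact: aN.
pose E k := [set w | 2 * t < `|block_sum h a (a + k) w|].
pose G k := [set w | `|block_sum h (a + k) (a + n) w| <= t].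
pose A k := seqDU E k.
have hE j k : (j <= k)%N -> history X (block a (a + k)) (E j).
  move=> jk; apply: (@history_sub _ _ _ _ _ (block a (a + j))).
    move=> i /= /andP[ai ij]; apply/andP; split=> //.
    by rewrite (leq_trans ij)// leq_add2l.
  by apply: adapted_gt; exact: aN.
have hA k : history X (block a (a + k)) (A k).
  rewrite /A /seqDU setDE; apply: history_setI; first exact: hE.
  apply: history_setC; rewrite -bigcup_mkord bigcup_mkcond.
  apply: history_bigcup => j; case: ifPn; last by move=> _; exact: history_set0.
  by rewrite inE/= => jk; apply: hE; exact: ltnW.
have hG k : history X (block (a + k) (a + n)) (G k) by apply: adapted_le; exact: aN.
have mA k : measurable (A k) by exact: history_measurable (hA k).
have mG k : measurable (G k) by exact: history_measurable (hG k).
have AG k : (k <= n)%N -> (P (A k) <= 2%:E * P (A k `&` G k))%E.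
  move=> kn; rewrite (indep_history indX _ (hA k) (hG k)); last exact: disjoint_blocks.
  have : ((2^-1)%:E <= P (G k))%E.
    rewrite (_ : G k = ~` [set w | t < `|block_sum h (a + k) (a + n) w|]); last first.
      by apply/seteqP; split=> w; rewrite /G/= ltNge;
        [move=> ->|move/negP; rewrite negbK].
    rewrite probability_setC//; have := half _ kn.
    rewrite -(fineK (fin_num_measure P _ (mgt (a + k)%N (a + n)%N t))).
    by rewrite -EFinB !lee_fin => ?; lra.
  rewrite -(fineK (fin_num_measure P _ (mA k))) -(fineK (fin_num_measure P _ (mG k))).
  rewrite -!EFinM !lee_fin => Gk.
  have : 0 <= fine (P (A k)) by rewrite fine_ge0.
  by nra.
have -> : [set w | exists2 k, (k <= n)%N & 2 * t < `|block_sum h a (a + k) w|] =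
    \big[setU/set0]_(k < n.+1) A k.
  rewrite (_ : \big[_/_]_(_ < _) _ = \big[setU/set0]_(k < n.+1) E k); last first.
    exact: (esym (bigsetU_seqDU _ _)).
  rewrite -bigcup_mkord; apply/seteqP; split=> [w [k kn kt]|w [k kn kt]]; exists k => //.
have tA : trivIset setT A by exact: trivIset_seqDU.
rewrite measure_bigsetU//.
apply: (@le_trans _ _ (\sum_(k < n.+1) 2%:E * P (A k `&` G k))%E).
  by apply: lee_sum => k _; apply: AG; rewrite -ltnS.
rewrite -ge0_sume_distrr; last by move=> k _; exact: measure_ge0.
apply: lee_wpmul2l; first by rewrite lee_fin.
have tAG : trivIset setT (fun k => A k `&` G k) by exact: trivIset_setIr.
have mAG k : measurable (A k `&` G k) by exact: measurableI.
have <- : P (\big[setU/set0]_(k < n.+1) (A k `&` G k)) =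
    (\sum_(k < n.+1) P (A k `&` G k))%E.
  apply: (measure_bigsetU P mAG tAG).
apply: le_measure; rewrite ?inE//.
  by apply: bigsetU_measurable => k _; exact: measurableI.
rewrite -(bigcup_mkord _ (fun k => A k `&` G k)) => w [k /= kn [[Ek _] Gk]].
have := ler_normB (block_sum h a (a + n) w) (block_sum h (a + k) (a + n) w).
have := @block_sum_cat h a (a + k) (a + n) w (leq_addr _ _).
rewrite leq_add2l -ltnS => /(_ kn) ->; rewrite addrK.
by move: Ek Gk; rewrite /E /G /= => ? ? ?; lra.
Qed.

End BlockSums.

(** * Exponential moments of i.i.d. sums *)

Section IidSums.
Context d (T : measurableType d) (R : realType) (P : probability T R).
Variable X : nat -> {RV P >-> R}.
Hypothesis iidX : iid X.

Let indX : independent_RVs X. Proof. by case: iidX. Qed.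

Lemma prob_ident (i : nat) (B : set R) :
  measurable B -> P (X i @^-1` B) = P (X 0%N @^-1` B).
Proof. by move=> mB; have [_ idX] := iidX; exact: (idX i 0%N B mB). Qed.

Lemma Rintegral_ident (i : nat) (g : R -> R) (M : R) :
  measurable_fun setT g -> (forall x, `|g x| <= M) ->
  \int[P]_w g (X i w) = \int[P]_w g (X 0%N w).
Proof.
move=> mg gM; rewrite /Rintegral; congr fine.
have ig j : P.-integrable setT (EFin \o (g \o X j)).
  apply: (@bounded_integrable _ _ _ _ _ M) => [|w]; last exact: gM.
  exact: measurableT_comp.
have mEg : measurable_fun setT (EFin \o g) by exact/measurable_EFinP.
have E k : (\int[P]_w (g (X k w))%:E = \int[distribution P (X k)]_x (g x)%:E)%E.
  by rewrite integral_distribution//; exact: ig.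
rewrite !E; apply: eq_measure_integral => B mB _.
by have [_ idX] := iidX; exact: idX.
Qed.

Lemma prob_le_Rintegral (A : set T) (f : T -> R) :
  measurable A -> P.-integrable setT (EFin \o f) ->
  (forall w, 0 <= f w) -> (forall w, A w -> 1 <= f w) ->
  (P A <= (\int[P]_w f w)%:E)%E.
Proof.
move=> mA intf f0 f1.
rewrite /Rintegral fineK; last exact: integrable_fin_num.
rewrite -[P A]mul1e -(integral_cst P mA 1).
apply: (@le_trans _ _ (\int[P]_(w in A) (f w)%:E)%E).
  apply: ge0_le_integral => //.
  by apply: measurable_funTS; have /integrableP[] := intf.
apply: ge0_subset_integral => //.
  by have /integrableP[] := intf.
by move=> w _; rewrite lee_fin.
Qed.

Lemma block_sum_bounded (h : R -> R) (M : R) a b w : (forall x, `|h x| <= M) ->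
  `|block_sum X h a b w| <= M *+ (b - a).
Proof.
move=> hM; rewrite /block_sum (le_trans (ler_norm_sum _ _ _))//.
by rewrite -sumr_const_nat; apply: ler_sum.
Qed.

Lemma Rintegral_expR_block_sum (h : R -> R) (M l : R) (a n : nat) :
  measurable_fun setT h -> (forall x, `|h x| <= M) ->
  \int[P]_w expR (l * block_sum X h a (a + n) w) =
  (\int[P]_w expR (l * h (X 0%N w))) ^+ n.
Proof.
move=> mh hM.
have mel : measurable_fun setT (fun x : R => expR (l * x)).
  apply: measurableT_comp; first exact: measurable_expR.
  exact: measurable_funM.
have bexp (y K : R) : `|y| <= K -> `|expR (l * y)| <= expR (`|l| * K).
  move=> yK; rewrite ger0_norm ?expR_ge0// ler_expR (le_trans (ler_norm _))//.
  by rewrite normrM ler_wpM2l.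
elim: n => [|n IH].
  rewrite addn0 expr0 /block_sum.
  under eq_Rintegral => w _ do rewrite big_geq// mulr0 expR0.
  by rewrite Rintegral_cst// mul1r [X in fine X]probability_setT.
rewrite addnS block_sum_recr ?leq_addr// exprSr -IH.
under eq_Rintegral => w _ do rewrite mulrDr expRD.
rewrite (@Rintegral_mul_adapted _ _ _ _ X indX
   (block a (a + n)) (block (a + n) (a + n).+1)
   _ _ (expR (`|l| * (M *+ (a + n - a)))) (expR (`|l| * M)))//.
- congr (_ * _).
  apply: (@Rintegral_ident (a + n)%N (fun x => expR (l * h x)) (expR (`|l| * M))).
    by apply: (measurableT_comp mel).
  by move=> x; exact: bexp.
- exact: disjoint_blocks.
- by apply: (adapted_comp mel); exact: adapted_block_sum.
- rewrite -/(comp _ _); apply: (@adapted_comp _ _ _ _ _ _ (h \o X (a + n)%N) _ mel).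
  by rewrite -block_sum1; exact: adapted_block_sum.
- by move=> w; apply: bexp; exact: block_sum_bounded.
- by move=> w; apply: bexp.
Qed.

(** Chernoff's bound for both tails: the exponential moments of the summands
    multiply by independence, and the two signs account for the factor 2. *)
Lemma chernoff_block_sum (h : R -> R) (M l q t : R) (a n : nat) :
  measurable_fun setT h -> (forall x, `|h x| <= M) -> 0 <= l ->
  \int[P]_w expR (l * h (X 0%N w)) <= expR q ->
  \int[P]_w expR (- l * h (X 0%N w)) <= expR q ->
  (P [set w | (t < `|block_sum X h a (a + n) w|)%R]
    <= (2 * expR (q *+ n - l * t))%:E)%E.
Proof.
move=> mh hM l0 q1 q2.
have aS := @adapted_block_sum _ _ _ P X h a (a + n) mh.
have mS := adapted_measurable aS.
have one (e : R) : `|e| = 1 -> \int[P]_w expR (e * l * h (X 0%N w)) <= expR q ->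
    (P [set w | (t < e * block_sum X h a (a + n) w)%R]
    <= (expR (q *+ n - l * t))%:E)%E.
  move=> e1 qe.
  have mSe : measurable_fun setT (fun w => e * block_sum X h a (a + n) w).
    exact: measurable_funM.
  have mA : measurable [set w | t < e * block_sum X h a (a + n) w].
    by apply: history_measurable; apply: (@adapted_gt _ _ _ _ X _ _ t);
      apply: (adapted_comp _ aS); exact: measurable_funM.
  have mF : measurable_fun setT
      (fun w => expR (e * l * block_sum X h a (a + n) w)).
    by apply: measurableT_comp; [exact: measurable_expR|exact: measurable_funM].
  have iF : P.-integrable setT
     (EFin \o (fun w => expR (e * l * block_sum X h a (a + n) w))).
    apply: (@bounded_integrable _ _ _ _ _ (expR (l * (M *+ n)))) => // w.
    rewrite ger0_norm ?expR_ge0// ler_expR (le_trans (ler_norm _))//.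
    rewrite !normrM e1 mul1r ger0_norm// ler_wpM2l//.
    by rewrite (le_trans (block_sum_bounded _ _ _ hM))// addKn.
  have mG : measurable_fun setT
      (fun w => expR (e * l * block_sum X h a (a + n) w) * expR (- (l * t))).
    exact: measurable_funM.
  apply: (@le_trans _ _ (\int[P]_w
      (expR (e * l * block_sum X h a (a + n) w) * expR (- (l * t))))%:E).
    apply: prob_le_Rintegral => //.
    - have -> : (EFin \o (fun w => expR (e * l * block_sum X h a (a + n) w) *
                       expR (- (l * t)))) =
        (fun w => (expR (- (l * t)))%:E *
           (expR (e * l * block_sum X h a (a + n) w))%:E)%E.
        by apply/funext => w /=; rewrite mulrC.
      by apply: integrableZl.
    - move=> w /= tS; rewrite -expRD -expR0 ler_expR.
      rewrite (_ : _ + _ = l * (e * block_sum X h a (a + n) w - t)); last by ring.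
      by rewrite mulr_ge0// subr_ge0 ltW.
  rewrite RintegralZr// (Rintegral_expR_block_sum _ _ _ mh hM) lee_fin expRD.
  rewrite ler_wpM2r ?expR_ge0// -mulr_natl expRM_natl lerXn2r// ?nnegrE ?expR_ge0//.
  by apply: Rintegral_ge0 => w _; exact: expR_ge0.
have sub : [set w | t < `|block_sum X h a (a + n) w|] `<=`
    [set w | t < 1 * block_sum X h a (a + n) w] `|`
    [set w | t < -1 * block_sum X h a (a + n) w].
  by move=> w /=; rewrite mul1r mulN1r ltr_normr => /orP[|]; [left|right].
have mE e : measurable [set w | t < e * block_sum X h a (a + n) w].
  by apply: history_measurable; apply: (@adapted_gt _ _ _ _ X _ _ t);
      apply: (adapted_comp _ aS); exact: measurable_funM.
apply: (le_trans (le_measure P _ _ sub)); rewrite ?inE.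
- apply: history_measurable; apply: adapted_gt.
  apply: (@adapted_comp _ _ _ _ _ _ _ (fun x => `|x|)); first exact: normr_measurable.
  exact: aS.
- exact: measurableU.
apply: (le_trans (measureU2 _ _ _)) => //.
rewrite mulr_natl mulr2n EFinD; apply: leeD.
- by apply: one; rewrite ?normr1// mul1r.
- by apply: one; rewrite ?normrN1// mulN1r.
Qed.

End IidSums.

(** * Anti-concentration of sums *)

Section NonDegenerate.
Context d (T : measurableType d) (R : realType) (P : probability T R).

(** Otherwise the law jumps from 0 to 1 at the supremum of the points below
    which it has no mass, and the variable is almost surely equal to it. *)
Lemma non_degenerate_split (Y : {RV P >-> R}) : non_degenerate Y ->
  exists a b : R, [/\ a < b, P [set w | (Y w <= a)%R] != 0%E &
                             P [set w | (b <= Y w)%R] != 0%E].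
Proof.
move=> ndY; apply: contrapT => H.
have mY : measurable_fun setT Y by exact: measurable_funP.
have mle x : measurable [set w | Y w <= x] by exact: measurable_le_level.
have mge x : measurable [set w | x <= Y w] by exact: measurable_ge_level.
have {}H a b : a < b -> P [set w | Y w <= a] = 0%E \/ P [set w | b <= Y w] = 0%E.
  move=> ab; have [|Pa] := eqVneq (P [set w | Y w <= a]) 0%E; first by left.
  have [|Pb] := eqVneq (P [set w | b <= Y w]) 0%E; first by right.
  by exfalso; apply: H; exists a, b.
have mono x y : x <= y -> P [set w | Y w <= y] = 0%E -> P [set w | Y w <= x] = 0%E.
  move=> xy Py; apply/eqP; rewrite -measure_le0 -Py; apply: le_measure; rewrite ?inE//.
  by move=> w /= /le_trans; apply.
have PT : P [set: T] != 0%E by rewrite probability_setT onee_neq0.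
have cover (A : nat -> set T) : (forall n, measurable (A n)) ->
    (forall n, P (A n) = 0%E) ->
    \bigcup_n A n = [set: T] -> False.
  move=> mA A0 AT; move/eqP: PT; apply; rewrite -AT.
  have mU : measurable (\bigcup_n A n) by exact: bigcupT_measurable.
  apply/(negligibleP P mU); apply: negligible_bigcup => n.
  by apply/(negligibleP P (mA n)); exact: A0.
pose S := [set x | P [set w | Y w <= x] = 0%E].
have S0 : S !=set0.
  apply: contrapT => S0.
  have ge0 b : P [set w | b <= Y w] = 0%E.
    have [h|//] := H (b - 1) b ltac:(by rewrite ltrBlDr ltrDl).
    by exfalso; apply: S0; exists (b - 1).
  apply: (cover (fun n => [set w | - n%:R <= Y w])) => //.
  rewrite -subTset => w _; exists (Num.truncn `|Y w|).+1 => //=.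
  rewrite lerNl (le_trans (ler_norm _))// normrN.
  exact/ltW/truncnS_gt.
have [y Sy] : exists y, ~ S y.
  apply: contrapT => h.
  apply: (cover (fun n => [set w | Y w <= n%:R])) => //.
    by move=> n; apply: contrapT => hn; apply: h; exists n%:R.
  rewrite -subTset => w _; exists (Num.truncn `|Y w|).+1 => //=.
  by rewrite (le_trans (ler_norm _))//; exact/ltW/truncnS_gt.
have ubS : has_ubound S.
  exists y => x Sx; rewrite leNgt; apply/negP => /ltW yx.
  by apply: Sy; exact: mono yx Sx.
have supS : has_sup S by split.
apply: ndY; exists (sup S).
have below n : {ae P, forall w, sup S - n.+1%:R^-1 < Y w}.
  have [x Sx xs] := sup_adherent (ltac:(by rewrite invr_gt0) : (0 : R) < n.+1%:R^-1) supS.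
  exists [set w | Y w <= x]; split=> // w /= /negP; rewrite -leNgt => /le_trans; apply.
  exact: ltW.
have above n : {ae P, forall w, Y w < sup S + n.+1%:R^-1}.
  exists [set w | sup S + n.+1%:R^-1 <= Y w]; split=> //; last first.
    by move=> w /= /negP; rewrite -leNgt.
  pose e : R := n.+1%:R^-1; have e0 : 0 < e by rewrite invr_gt0.
  have [h|//] := H (sup S + e / 2) (sup S + e)
    ltac:(by rewrite ltrD2l gtr_pMr// invf_lt1// ltr1n).
  have : sup S + e / 2 <= sup S by apply: (sup_upper_bound supS); exact: h.
  by rewrite gerDl leNgt divr_gt0.
near=> w.
have lo : forall n : nat, sup S - n.+1%:R^-1 < Y w by near: w; exact: ae_foralln.
have hi : forall n : nat, Y w < sup S + n.+1%:R^-1 by near: w; exact: ae_foralln.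
apply/eqP; rewrite eq_le; apply/andP; split.
  apply/ler_addgt0Pr => e e0; have [n _ ne] := near_infty_natSinv_lt (PosNum e0).
  by rewrite ltW// (lt_trans (hi n))// ltrD2l; apply: (ne n) => /=.
apply/ler_addgt0Pr => e e0; have [n _ ne] := near_infty_natSinv_lt (PosNum e0).
by rewrite -lerBlDr ltW// (le_lt_trans _ (lo n))// lerD2l lerN2 ltW//;
  apply: (ne n) => /=.
Unshelve. all: by end_near. Qed.

(** Cutting the two half-lines at a large [M] keeps positive mass on each by
    countable subadditivity. *)
Lemma non_degenerate_bounded_split (Y : {RV P >-> R}) : non_degenerate Y ->
  exists a b M p : R, [/\ a < b, 0 < M, 0 < p,
    (p%:E <= P [set w | (- M <= Y w <= a)%R])%E &
    (p%:E <= P [set w | (b <= Y w <= M)%R])%E].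
Proof.
move=> /non_degenerate_split[a [b [ab Pa Pb]]].
have mY : measurable_fun setT Y by exact: measurable_funP.
have mitv (u v : R) : measurable [set w | u <= Y w <= v].
  exact: measurable_band.
have trunc (B : set T) (A : nat -> set T) : P B != 0%E ->
    (forall n, measurable (A n)) -> measurable B -> B `<=` \bigcup_n A n ->
    exists n, P (A n) != 0%E.
  move=> PB mA mB BA; apply: contrapT => h; move/eqP: PB; apply.
  apply/(negligibleP P mB); apply: negligibleS BA _; apply: negligible_bigcup => n.
  by apply/(negligibleP P (mA n)); apply: contrapT => /eqP hn; apply: h; exists n.
have mle x : measurable [set w | Y w <= x] by exact: measurable_le_level.
have mge x : measurable [set w | x <= Y w] by exact: measurable_ge_level.
have [n Pn] := trunc _ (fun n => [set w | - n%:R <= Y w <= a]) Pa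
  ltac:(by []) (mle a) ltac:(move=> w /= wa; exists (Num.truncn `|Y w|).+1 => //=;
    by rewrite wa andbT lerNl (le_trans (ler_norm _))// normrN; exact/ltW/truncnS_gt).
have [m Pm] := trunc _ (fun n => [set w | b <= Y w <= n%:R]) Pb
  ltac:(by []) (mge b) ltac:(move=> w /= bw; exists (Num.truncn `|Y w|).+1 => //=;
    by rewrite bw/= (le_trans (ler_norm _))//; exact/ltW/truncnS_gt).
pose M : R := (maxn n m).+1%:R.
pose A := [set w | - M <= Y w <= a]; pose B := [set w | b <= Y w <= M].
have pos (C D : set T) : measurable C -> measurable D -> C `<=` D ->
    P C != 0%E -> 0 < fine (P D).
  move=> mC mD CD PC; rewrite fine_gt0//.
  apply/andP; split; last by rewrite ltey_eq fin_num_measure.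
  by rewrite (lt_le_trans _ (le_measure P _ _ CD)) ?inE// lt0e PC measure_ge0.
have A0 : 0 < fine (P A).
  apply: (pos _ _ (mitv _ _) (mitv _ _) _ Pn) => w /= /andP[nw ->].
  rewrite andbT (le_trans _ nw)// lerN2 ler_nat.
  by rewrite leqW// leq_maxl.
have B0 : 0 < fine (P B).
  apply: (pos _ _ (mitv _ _) (mitv _ _) _ Pm) => w /= /andP[-> wn] /=.
  rewrite (le_trans wn)// ler_nat.
  by rewrite leqW// leq_maxr.
exists a, b, M, (Num.min (fine (P A)) (fine (P B))); split=> //.
- by rewrite lt_min A0.
- by rewrite -[leRHS](fineK (fin_num_measure P _ (mitv _ _))) lee_fin ge_min lexx.
- by rewrite -[leRHS](fineK (fin_num_measure P _ (mitv _ _))) lee_fin ge_min lexx orbT.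
Qed.

End NonDegenerate.

Section AntiConcentration.
Context d (T : measurableType d) (R : realType) (P : probability T R).

Lemma sin_increment_ge (u v : R) : -1 <= u -> u <= v -> v <= 1 ->
  cos 1 * (v - u) <= sin v - sin u.
Proof.
move=> u1 uv v1.
have [c + ->] := MVT_segment uv (fun x _ => is_derive_sin x)
  (continuous_subspaceT (@continuous_sin R)).
rewrite in_itv/= => /andP[uc cv]; rewrite ler_wpM2r ?subr_ge0//.
have c1 : `|c| <= 1 by rewrite ler_norml (le_trans u1 uc) (le_trans cv v1).
have pi1 : 1 <= pi :> R by rewrite (le_trans _ (pi_ge2 R))// ler1n.
rewrite -(cos_norm c) leNgt ltr_cos ?in_itv/= ?normr_ge0 ?ler01//= -?leNgt//.
by rewrite (le_trans c1).
Qed.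

Lemma one_minus_cos_le (y : R) : 1 - cos y <= `|y|.
Proof.
rewrite -cos_norm; set z := `|y|.
have [c _] := MVT_segment (normr_ge0 y) (fun x _ => is_derive_cos x)
  (continuous_subspaceT (@continuous_cos R)).
rewrite cos0 subr0 => h.
have -> : 1 - cos z = sin c * z by rewrite -[LHS]opprB h mulNr opprK.
by rewrite -[leRHS]mul1r ler_wpM2r ?normr_ge0// sin_le1.
Qed.

Variable X : nat -> {RV P >-> R}.
Hypothesis iidX : iid X.

Let indX : independent_RVs X. Proof. by case: iidX. Qed.

Let measurable_cosM (s : R) : measurable_fun setT (fun x : R => cos (s * x)).
Proof.
apply: (@measurableT_comp _ _ _ _ _ _ cos); last exact: measurable_funM.
by apply: continuous_measurable_fun; exact: continuous_cos.
Qed.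

Let measurable_sinM (s : R) : measurable_fun setT (fun x : R => sin (s * x)).
Proof.
apply: (@measurableT_comp _ _ _ _ _ _ sin); last exact: measurable_funM.
by apply: continuous_measurable_fun; exact: continuous_sin.
Qed.

Definition charfun_re (s : R) (a b : nat) : R :=
  \int[P]_w cos (s * block_sum X id a b w).
Definition charfun_im (s : R) (a b : nat) : R :=
  \int[P]_w sin (s * block_sum X id a b w).

(** By the addition formulas, the pairs (cosine part, sine part) multiply like
    complex numbers over independent summands, hence so do their squared
    norms. *)
Lemma charfun_block_sum (s : R) (a n : nat) :
  charfun_re s a (a + n) ^+ 2 + charfun_im s a (a + n) ^+ 2 =
  ((\int[P]_w cos (s * X 0%N w)) ^+ 2 + (\int[P]_w sin (s * X 0%N w)) ^+ 2) ^+ n.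
Proof.
set c := \int[P]_w cos _; set z := \int[P]_w sin _.
elim: n => [|n IH].
  rewrite addn0 expr0 /charfun_re /charfun_im /block_sum.
  under eq_Rintegral => w _ do rewrite big_geq// mulr0 cos0.
  under [X in _ + X ^+ 2]eq_Rintegral => w _ do rewrite big_geq// mulr0 sin0.
  rewrite !Rintegral_cst// mul0r expr0n/= addr0.
  by rewrite mul1r [X in fine X]probability_setT expr1n.
rewrite addnS [in RHS]exprSr -IH.
have D := @disjoint_blocks a (a + n) (a + n) (a + n).+1 (leqnn _).
have aS := @adapted_block_sum _ _ _ P X id a (a + n) (@measurable_id _ _ setT).
have aX : adapted X (block (a + n) (a + n).+1) (X (a + n)%N).
  have := @adapted_block_sum _ _ _ P X id (a + n) (a + n).+1 (@measurable_id _ _ setT).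
  by rewrite block_sum1.
have mul (f g : R -> R) : measurable_fun setT f -> measurable_fun setT g ->
    (forall x, `|f x| <= 1) -> (forall x, `|g x| <= 1) ->
    \int[P]_w (f (block_sum X id a (a + n) w) * g (X (a + n)%N w)) =
    \int[P]_w f (block_sum X id a (a + n) w) * \int[P]_w g (X 0%N w).
  move=> mf mg f1 g1.
  rewrite (@Rintegral_mul_adapted _ _ _ _ _ indX _ _
    (f \o block_sum X id a (a + n)) (g \o X (a + n)%N) 1 1 D).
  - by congr (_ * _); apply: (Rintegral_ident iidX) mg g1.
  - exact: adapted_comp.
  - exact: adapted_comp.
  - by move=> w; exact: f1.
  - by move=> w; exact: g1.
have int2 (f g : R -> R) : measurable_fun setT f -> measurable_fun setT g ->
    (forall x, `|f x| <= 1) -> (forall x, `|g x| <= 1) ->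
    P.-integrable setT (EFin \o
      (fun w => f (block_sum X id a (a + n) w) * g (X (a + n)%N w))).
  move=> mf mg f1 g1; apply: (@bounded_integrable _ _ _ _ _ 1).
    apply: measurable_funM; first exact: (adapted_measurable (adapted_comp mf aS)).
    exact: (adapted_measurable (adapted_comp mg aX)).
  by move=> w; rewrite normrM mulr_ile1.
have mc := measurable_cosM s; have ms := measurable_sinM s.
have bc x : `|cos (s * x)| <= 1 by exact: cos_max.
have bs x : `|sin (s * x)| <= 1 by exact: sin_max.
have -> : charfun_re s a (a + n).+1 =
    charfun_re s a (a + n) * c - charfun_im s a (a + n) * z.
  rewrite /charfun_re block_sum_recr ?leq_addr//.
  under eq_Rintegral => w _ do rewrite mulrDr cosD.
  rewrite RintegralB//.
  - by rewrite (mul _ _ mc mc bc bc) (mul _ _ ms ms bs bs).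
  - exact: (int2 _ _ mc mc bc bc).
  - exact: (int2 _ _ ms ms bs bs).
have -> : charfun_im s a (a + n).+1 =
    charfun_im s a (a + n) * c + charfun_re s a (a + n) * z.
  rewrite /charfun_im block_sum_recr ?leq_addr//.
  under eq_Rintegral => w _ do rewrite mulrDr sinD.
  rewrite RintegralD//.
  - by rewrite (mul _ _ ms mc bs bc) (mul _ _ mc ms bc bs).
  - exact: (int2 _ _ ms mc bs bc).
  - exact: (int2 _ _ mc ms bc bs).
by ring.
Qed.

Hypothesis ndX : non_degenerate (X 0%N).

(** [1 - |phi(s)|^2] dominates the variance of [sin (s X)], which is of order
    [s^2] because [X] takes separated values with positive probability. *)
Lemma charfun_near0 : exists k M : R, [/\ 0 < k, 0 < M &
  forall s, 0 < s -> s <= M^-1 ->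
  (\int[P]_w cos (s * X 0%N w)) ^+ 2 + (\int[P]_w sin (s * X 0%N w)) ^+ 2
    <= 1 - k * s ^+ 2].
Proof.
have [a [b [M [p [ab M0 p0 pA pB]]]]] := non_degenerate_bounded_split ndX.
exists ((cos 1 * (b - a) / 2) ^+ 2 * p), M; split=> //.
  by rewrite mulr_gt0// exprn_gt0// divr_gt0// mulr_gt0 ?cos1_gt0// subr_gt0.
move=> s s0 sM.
set c := \int[P]_w cos _; set z := \int[P]_w sin _.
have mX : measurable_fun setT (X 0%N) by exact: measurable_funP.
have mc : measurable_fun setT (fun w => cos (s * X 0%N w)).
  exact: (measurableT_comp (measurable_cosM s)).
have ms : measurable_fun setT (fun w => sin (s * X 0%N w)).
  exact: (measurableT_comp (measurable_sinM s)).
have ic : P.-integrable setT (EFin \o (fun w => cos (s * X 0%N w))).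
  by apply: (@bounded_integrable _ _ _ _ _ 1) => // w; exact: cos_max.
have is_ : P.-integrable setT (EFin \o (fun w => sin (s * X 0%N w))).
  by apply: (@bounded_integrable _ _ _ _ _ 1) => // w; exact: sin_max.
have sq (f : T -> R) (m : R) : measurable_fun setT f -> (forall w, `|f w| <= 1) ->
    `|m| <= 1 ->
    P.-integrable setT (EFin \o (fun w => (f w - m) ^+ 2)) /\
    \int[P]_w (f w - m) ^+ 2 =
    \int[P]_w f w ^+ 2 - 2 * m * \int[P]_w f w + m ^+ 2.
  move=> mf f1 m1.
  have if1 : P.-integrable setT (EFin \o f) by exact: bounded_integrable f1.
  have if2 : P.-integrable setT (EFin \o (fun w => f w ^+ 2)).
    apply: (@bounded_integrable _ _ _ _ _ 1); first exact: measurable_funX.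
    by move=> w; rewrite normrX exprn_ile1.
  have if3 : P.-integrable setT (EFin \o (fun w => 2 * m * f w)).
    have -> : (EFin \o (fun w => 2 * m * f w)) = (fun w => (2 * m)%:E * (f w)%:E)%E.
      by apply/funext => w /=; rewrite EFinM.
    exact: integrableZl.
  have im : P.-integrable setT (EFin \o (fun=> m ^+ 2)).
    exact: finite_measure_integrable_cst.
  have if23 : P.-integrable setT (EFin \o (fun w => f w ^+ 2 - 2 * m * f w)).
    exact: (integrableB measurableT if2 if3).
  have e w : (f w - m) ^+ 2 = f w ^+ 2 - 2 * m * f w + m ^+ 2 by ring.
  split.
    rewrite (_ : _ \o _ = EFin \o (fun w => (f w ^+ 2 - 2 * m * f w) + m ^+ 2)).
      exact: (integrableD measurableT if23 im).
    by apply/funext => w /=; rewrite e.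
  under eq_Rintegral => w _ do rewrite e.
  rewrite RintegralD// RintegralB// RintegralZl// Rintegral_cst//.
  by rewrite [X in fine X]probability_setT mulr1.
have cE : `|c| <= 1.
  rewrite (le_trans (le_normr_Rintegral _ ic))//.
  have := @le_Rintegral _ _ _ P setT
    (fun w => `|cos (s * X 0%N w)|) (fun=> 1) measurableT.
  rewrite Rintegral_cst// [X in fine X]probability_setT mul1r; apply.
  - exact: integrable_abse ic.
  - exact: finite_measure_integrable_cst.
  - by move=> w _; exact: cos_max.
have zE : `|z| <= 1.
  rewrite (le_trans (le_normr_Rintegral _ is_))//.
  have := @le_Rintegral _ _ _ P setT
    (fun w => `|sin (s * X 0%N w)|) (fun=> 1) measurableT.
  rewrite Rintegral_cst// [X in fine X]probability_setT mul1r; apply.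
  - exact: integrable_abse is_.
  - exact: finite_measure_integrable_cst.
  - by move=> w _; exact: sin_max.
have [_ Vc] := sq _ c mc (fun w => cos_max _) cE.
have [iVs Vs] := sq _ z ms (fun w => sin_max _) zE.
have [ic2 _] := sq _ 0 mc (fun w => cos_max _) ltac:(by rewrite normr0).
have [is2 _] := sq _ 0 ms (fun w => sin_max _) ltac:(by rewrite normr0).
have cs : \int[P]_w cos (s * X 0%N w) ^+ 2 + \int[P]_w sin (s * X 0%N w) ^+ 2 = 1.
  have sub0 (f : T -> R) : (fun w => (f w - 0) ^+ 2) = (fun w => f w ^+ 2).
    by apply/funext => w; rewrite subr0.
  rewrite !sub0 in ic2 is2.
  rewrite -RintegralD//.
  under eq_Rintegral => w _ do rewrite cos2Dsin2.
  by rewrite Rintegral_cst// [X in fine X]probability_setT mulr1.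
have Vc0 : 0 <= \int[P]_w (cos (s * X 0%N w) - c) ^+ 2.
  by apply: Rintegral_ge0 => w _; exact: sqr_ge0.
rewrite -/c in Vc; rewrite -/z in Vs.
(* E cos^2 + E sin^2 = 1, so 1 - c^2 - z^2 is the sum of the two variances *)
suff : (cos 1 * (b - a) / 2) ^+ 2 * p * s ^+ 2 <=
    \int[P]_w (sin (s * X 0%N w) - z) ^+ 2 by nra.
pose D := s * (cos 1 * (b - a)) / 2.
have D0 : 0 < D by rewrite divr_gt0// mulr_gt0// mulr_gt0 ?cos1_gt0// subr_gt0.
have -> : (cos 1 * (b - a) / 2) ^+ 2 * p * s ^+ 2 = p * D ^+ 2 by rewrite /D; field.
rewrite -ler_pdivlMr ?exprn_gt0//.
have iVD : P.-integrable setT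
    (EFin \o (fun w => (sin (s * X 0%N w) - z) ^+ 2 / D ^+ 2)).
  rewrite (_ : EFin \o _ =
      (fun w => (D ^+ 2)^-1%:E * ((sin (s * X 0%N w) - z) ^+ 2)%:E)%E).
    exact: integrableZl.
  by apply/funext => w /=; rewrite mulrC EFinM.
rewrite -RintegralZr// -lee_fin.
have mitv (u v : R) : measurable [set w | u <= X 0%N w <= v].
  exact: measurable_band.
have ge1 y : D <= `|y| -> 1 <= y ^+ 2 / D ^+ 2.
  move=> Dy; rewrite ler_pdivlMr ?exprn_gt0// mul1r -(real_normK (num_real y)).
  by rewrite lerXn2r// ?nnegrE ltW.
have sM1 y : `|y| <= M -> `|s * y| <= 1.
  move=> yM; rewrite normrM gtr0_norm//.
  rewrite (le_trans (ler_wpM2l (ltW s0) yM))//.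
  by rewrite (le_trans (ler_wpM2r (ltW M0) sM))// mulVf// gt_eqF.
have sgap x y : -M <= x -> x <= a -> b <= y -> y <= M ->
    D + D <= sin (s * y) - sin (s * x).
  move=> Mx xa bY yM.
  have -> : D + D = cos 1 * (s * (b - a)) by rewrite /D; field.
  have xy : x <= y by rewrite (le_trans xa)// (le_trans (ltW ab)).
  have /ler_normlP[_ h1] := sM1 y ltac:(by rewrite ler_norml yM (le_trans Mx xy)).
  have /ler_normlP[h2 _] := sM1 x ltac:(by rewrite ler_norml Mx (le_trans xy yM)).
  have sx1 : -1 <= s * x by rewrite lerNl.
  have sxy : s * x <= s * y by rewrite ler_wpM2l// ltW.
  apply: le_trans (sin_increment_ge sx1 sxy h1).
  rewrite ler_wpM2l ?(ltW (cos1_gt0 _))// -mulrBr ler_wpM2l ?(ltW s0)//.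
  exact: lerB.
(* the values on the two events are 2D apart, so z is D-far from one of them *)
have [farA|] := pselect (forall x, - M <= x -> x <= a -> D <= `|sin (s * x) - z|).
  apply: (le_trans pA); apply: prob_le_Rintegral => //.
  by move=> w; rewrite divr_ge0 ?sqr_ge0.
  by move=> w /= /andP[MX Xa]; apply: ge1; exact: farA.
move=> /existsNP[x /not_implyP[Mx /not_implyP[xa /negP]]]; rewrite -ltNge => xz.
apply: (le_trans pB); apply: prob_le_Rintegral => //.
  by move=> w; rewrite divr_ge0 ?sqr_ge0.
move=> w /= /andP[bX XM]; apply: ge1.
have := sgap x (X 0%N w) Mx xa bX XM.
have := ler_distD z (sin (s * X 0%N w)) (sin (s * x)).
have := ler_norm (sin (s * X 0%N w) - sin (s * x)).
by move: xz; rewrite (distrC (sin (s * x)) z); lra.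
Qed.

End AntiConcentration.

(** * The lower bound *)

Section LowerBound.
Context d (T : measurableType d) (R : realType) (P : probability T R).
Variable X : nat -> {RV P >-> R}.
Hypothesis iidX : iid X.
Hypothesis ndX : non_degenerate (X 0%N).

Let indX : independent_RVs X. Proof. by case: iidX. Qed.

(** At the frequency [1 / sqrt n] the characteristic function of a sum of [n]
    terms has modulus at most [expR (- k / 2) < 1]. As [1 - cos y <= |y|], the
    sum cannot be concentrated on the scale [tau * sqrt n]. *)
Lemma block_sum_spread : exists tau : R, 0 < tau /\ \forall n \near \oo, forall a,
  ((tau / 2)%:E <=
    P [set w | (tau * Num.sqrt n%:R < `|block_sum X id a (a + n) w|)%R])%E.
Proof.
have [k [M [k0 M0 kM]]] := charfun_near0 ndX.
exists ((1 - expR (- k / 2)) / 2); set tau := _ / 2.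
have tau0 : 0 < tau.
  by rewrite divr_gt0// subr_gt0 -expR0 ltr_expR mulNr oppr_lt0 divr_gt0.
split=> //; near=> n => a.
have n0 : (0 < n)%N by near: n; exists 1%N.
have nr0 : 0 < n%:R :> R by rewrite ltr0n.
have Mn : M ^+ 2 <= n%:R by near: n; exact: nbhs_infty_ger.
pose s : R := (Num.sqrt n%:R)^-1.
have sq0 : 0 < Num.sqrt n%:R :> R by rewrite sqrtr_gt0.
have s0 : 0 < s by rewrite invr_gt0.
have sM : s <= M^-1.
  rewrite lef_pV2 ?posrE// -[M]gtr0_norm// -sqrtr_sqr ler_wsqrtr//.
have s2 : s ^+ 2 = n%:R^-1 by rewrite exprVn sqr_sqrtr// ltW.
have := charfun_block_sum iidX s a n.
have := kM s s0 sM.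
set r := (X in X <= _) => r1.
have r0 : 0 <= r by rewrite addr_ge0 ?sqr_ge0.
set C := charfun_re _ _ _ _ => Cr.
have Ck : C <= expR (- k / 2).
  have : C ^+ 2 <= expR (- k / 2) ^+ 2.
    rewrite -expRM_natl (_ : 2 * (- k / 2) = - k); last by field.
    apply: (@le_trans _ _ (r ^+ n)); first by rewrite -Cr lerDl sqr_ge0.
    apply: (@le_trans _ _ (expR (- (k * s ^+ 2)) ^+ n)).
      by rewrite lerXn2r ?nnegrE ?expR_ge0// (le_trans r1)// expR_ge1Dx.
    rewrite -expRM_natl ler_expR s2 -mulr_natl.
    by rewrite mulrN mulrCA divff ?mulr1// gt_eqF.
  by move=> h; rewrite leNgt; apply/negP => h'; move: h;
    rewrite leNgt ltrXn2r// ltW ?expR_ge0.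
set S := block_sum X id a (a + n); set A := [set w | _].
have aS : adapted X (block a (a + n)) S.
  exact: (@adapted_block_sum _ _ _ P X id a (a + n) (@measurable_id _ _ setT)).
have mS := adapted_measurable aS.
have mA : measurable A.
  apply: history_measurable; apply: adapted_gt.
  apply: (@adapted_comp _ _ _ _ _ _ _ (fun x => `|x|)); first exact: normr_measurable.
  exact: aS.
have mc : measurable_fun setT (fun w => cos (s * S w)).
  apply: (@measurableT_comp _ _ _ _ _ _ cos); last exact: measurable_funM.
  by apply: continuous_measurable_fun; exact: continuous_cos.
have ic : P.-integrable setT (EFin \o (fun w => cos (s * S w))).
  by apply: (@bounded_integrable _ _ _ _ _ 1) => // w; exact: cos_max.
have i1 x : P.-integrable setT (EFin \o (fun=> x : R)).
  exact: finite_measure_integrable_cst.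
have mI : measurable_fun setT (\1_A : T -> R) by exact: measurable_indic.
have iI : P.-integrable setT (EFin \o (fun w => 2 * \1_A w : R)).
  apply: (@bounded_integrable _ _ _ _ _ 2); first exact: measurable_funM.
  move=> w; rewrite normrM ger0_norm// ler_piMr// indicE.
  by case: (w \in A); rewrite ?normr1 ?normr0.
have PA : fine (P A) = \int[P]_w \1_A w.
  by rewrite /Rintegral integral_indic// setIT.
have key : 1 - C <= tau + 2 * fine (P A).
  have ec : 1 - C = \int[P]_w (1 - cos (s * S w)).
    by rewrite RintegralB// Rintegral_cst// [X in fine X]probability_setT mulr1.
  have et : tau + 2 * fine (P A) = \int[P]_w (tau + 2 * \1_A w).
    rewrite PA RintegralD// Rintegral_cst// [X in fine X]probability_setT mulr1.
    rewrite RintegralZl//.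
    apply: (@bounded_integrable _ _ _ _ _ 1) => // w.
    by rewrite indicE; case: (w \in A); rewrite ?normr1 ?normr0.
  rewrite ec et; apply: le_Rintegral => //.
  - exact: (integrableB measurableT (i1 1) ic).
  - exact: (integrableD measurableT (i1 tau) iI).
  move=> w _; rewrite indicE; have [wA|wA] := boolP (w \in A).
    by rewrite mulr1; have := cos_geN1 (s * S w); lra.
  rewrite mulr0 addr0 (le_trans (one_minus_cos_le _))//.
  rewrite normrM gtr0_norm// mulrC ler_pdivrMr// leNgt.
  by apply/negP => h; move/negP: wA; apply; rewrite inE.
rewrite -[leRHS](fineK (fin_num_measure P _ mA)) lee_fin.
have : 2 * tau = 1 - expR (- k / 2) by rewrite /tau; field.
by move: key Ck; lra.
Unshelve. all: by end_near. Qed.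

Lemma partial_sum_block n w : partial_sum X n w = block_sum X id 1 n.+1 w.
Proof. by []. Qed.

Let dyadic_lt k : (2 ^ k < 2 ^ k.+1)%N. Proof. by rewrite ltn_exp2l. Qed.

Lemma trivIset_dyadic_blocks :
  trivIset setT (fun k => block (2 ^ k) (2 ^ k.+1)).
Proof.
apply/trivIsetP => i j _ _ ij.
wlog lt_ij : i j ij / (i < j)%N.
  move=> H; have [/H->//|ji|/eqP] := ltngtP i j; last by rewrite (negbTE ij).
  by rewrite setIC H// eq_sym.
apply/disj_set2P; apply: disjoint_blocks.
by rewrite leq_exp2l.
Qed.

(** The increments over dyadic blocks are independent, and each exceeds a
    multiple of its natural scale with probability bounded below, so almost
    surely infinitely many do; the sum at one of the two ends of such a block
    is then large as well. *)
Lemma partial_sum_frequently_large : exists theta : R, 0 < theta /\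
  {ae P, forall w, forall N, exists2 n, (N <= n)%N &
    theta * Num.sqrt n%:R < `|partial_sum X n w|}.
Proof.
have [tau [tau0 [n0 _ Hn0]]] := block_sum_spread.
(* the two ends have square roots at most 1 and 2 times sqrt (2 ^ k), and
   tau / 4 + 2 * (tau / 4) < tau *)
exists (tau / 4); split; first exact: divr_gt0.
pose A k := [set w | tau * Num.sqrt (2 ^ k)%:R < `|block_sum X id (2 ^ k) (2 ^ k.+1) w|].
have hA k : history X (block (2 ^ k) (2 ^ k.+1)) (A k).
  apply: adapted_gt.
  apply: (@adapted_comp _ _ _ _ _ _ _ (fun x => `|x|)); first exact: normr_measurable.
  exact: (@adapted_block_sum _ _ _ P X id _ _ (@measurable_id _ _ setT)).
have PA k : (n0 <= k)%N -> ((tau / 2)%:E <= P (A k))%E.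
  move=> nk; have := Hn0 (2 ^ k)%N _ (2 ^ k)%N.
  rewrite /= addnn -mul2n -expnS; apply.
  by rewrite (leq_trans nk)// ltnW// ltn_expl.
have sA : (\sum_(k <oo) P (A k) = +oo)%E.
  apply/eqyP => B B0.
  pose m := (n0 + (Num.truncn (B / (tau / 2))%R).+1)%N.
  have A0 k : (0 <= P (A k))%E by exact: measure_ge0.
  have mA k : measurable (A k) by exact: history_measurable (hA k).
  pose p k := fine (P (A k)).
  have pE k : P (A k) = (p k)%:E by rewrite fineK// fin_num_measure.
  apply: (@le_trans _ _ (\sum_(0 <= k < m) P (A k))%E); last first.
    by apply: nneseries_lim_ge => k _ _; exact: A0.
  rewrite (eq_bigr (fun k => (p k)%:E)); last by move=> k _; exact: pE.
  rewrite sumEFin lee_fin (big_cat_nat (leq0n n0) (leq_addr _ _))/=.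
  apply: (@le_trans _ _ (\sum_(n0 <= k < m) p k)); last first.
    by rewrite lerDr; apply: sumr_ge0 => k _; rewrite fine_ge0.
  apply: (@le_trans _ _ (\sum_(n0 <= k < m) (tau / 2))); last first.
    rewrite big_seq [leRHS]big_seq; apply: ler_sum => k.
    by rewrite mem_index_iota => /andP[nk _]; rewrite -lee_fin -pE; exact: PA.
  rewrite sumr_const_nat /m addKn -[leRHS]mulr_natr -ler_pdivrMl ?divr_gt0//.
  by rewrite mulrC; apply/ltW/truncnS_gt.
have := borel_cantelli_second indX trivIset_dyadic_blocks hA sA.
apply: filterS => w io N.
have [k Nk Ak] := io N.+1.
have k2 : (0 < 2 ^ k)%N by rewrite expn_gt0.
have Nk2 : (N <= (2 ^ k).-1)%N.
  by rewrite -ltnS prednK// (leq_trans _ (ltnW (ltn_expl k _)))// ltnW.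
have e2 : (2 ^ k.+1)%:R = 2 * (2 ^ k)%:R :> R by rewrite expnS natrM.
have q0 : 0 <= Num.sqrt (2 ^ k)%:R :> R by exact: sqrtr_ge0.
have small1 : Num.sqrt (2 ^ k).-1%:R <= Num.sqrt (2 ^ k)%:R :> R.
  by rewrite ler_wsqrtr// ler_nat leq_pred.
have small2 : Num.sqrt (2 ^ k.+1).-1%:R <= 2 * Num.sqrt (2 ^ k)%:R :> R.
  have -> : 2 * Num.sqrt (2 ^ k)%:R = Num.sqrt (4 * (2 ^ k)%:R) :> R.
    rewrite sqrtrM// (_ : 4 = 2 ^+ 2); last by ring.
    by rewrite sqrtr_sqr ger0_norm.
  rewrite ler_wsqrtr// (_ : 4 = 2 * 2); last by ring.
  rewrite -mulrA -e2 (@le_trans _ _ (2 ^ k.+1)%:R)// ?ler_nat ?leq_pred//.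
  by rewrite ler_peMl// ler1n.
have cut : block_sum X id (2 ^ k) (2 ^ k.+1) w =
    partial_sum X (2 ^ k.+1).-1 w - partial_sum X (2 ^ k).-1 w.
  rewrite !partial_sum_block !prednK ?expn_gt0//.
  rewrite (@block_sum_cat _ _ _ _ X id 1 (2 ^ k) (2 ^ k.+1))// ?(ltnW (dyadic_lt k))//.
  by rewrite addrAC subrr add0r.
have {}Ak : tau * Num.sqrt (2 ^ k)%:R <
    `|partial_sum X (2 ^ k.+1).-1 w| + `|partial_sum X (2 ^ k).-1 w|.
  by rewrite (lt_le_trans Ak)// cut ler_normB.
have [big|small] := ltP (tau / 4 * Num.sqrt (2 ^ k).-1%:R) `|partial_sum X (2 ^ k).-1 w|.
  by exists (2 ^ k).-1.
exists (2 ^ k.+1).-1.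
  by rewrite (leq_trans Nk2)// -!subn1 leq_sub2r// ltnW.
by nra.
Qed.

End LowerBound.

(** * The normalised limsup and powers of the logarithm *)

Section NormalizedLimsup.
Context d (T : measurableType d) (R : realType) (P : probability T R).
Variable X : nat -> {RV P >-> R}.

Lemma limn_esup_ge (u : nat -> \bar R) (l : \bar R) :
  (forall N, exists2 n, (N <= n)%N & (l <= u n)%E) -> (l <= limn_esup u)%E.
Proof.
move=> h; apply: le_ereal_inf_tmp => _ [V [N _ NV] <-].
have [n Nn ln] := h N; apply: (le_trans ln).
by apply: ereal_sup_ubound; exists n => //; exact: NV.
Qed.

Lemma limn_esup_le (u : nat -> \bar R) (l : \bar R) :
  (\forall n \near \oo, (u n <= l)%E) -> (limn_esup u <= l)%E.
Proof.
move=> h; apply: (@le_trans _ _ (ereal_sup (u @` [set n | (u n <= l)%E]))).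
  by apply: ereal_inf_lbound; exists [set n | (u n <= l)%E].
by apply: ge_ereal_sup => _ [n /= un <-].
Qed.

Lemma ln_ln_pos : \forall n \near \oo, 0 < ln (ln n%:R) :> R.
Proof.
near=> n; apply: ln_gt0.
have n1 : expR 1 < n%:R :> R by near: n; exact: nbhs_infty_gtr.
have n0 : 0 < n%:R :> R by rewrite (lt_trans _ n1)// expR_gt0.
by rewrite -[ltLHS]expRK ltr_ln ?posrE ?expR_gt0.
Unshelve. all: by end_near. Qed.

Lemma ln_ln_large (M : R) : \forall n \near \oo, M <= ln (ln n%:R) :> R.
Proof.
near=> n.
have h : expR (expR M) < n%:R by near: n; exact: nbhs_infty_gtr.
have n0 : 0 < n%:R :> R by rewrite (lt_trans _ h)// expR_gt0.
have h2 : expR M < ln n%:R.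
  by rewrite -[ltLHS]expRK ltr_ln ?posrE ?expR_gt0.
have l0 : 0 < ln n%:R :> R by rewrite (lt_trans _ h2)// expR_gt0.
by rewrite -[leLHS]expRK ler_ln ?posrE ?expR_gt0// ltW.
Unshelve. all: by end_near. Qed.

(** A constant factor disappears after taking the power [1 / log log n]. *)
Lemma limsup_norm_sum_ge1 (theta : R) w : 0 < theta ->
  (forall N, exists2 n, (N <= n)%N & theta * Num.sqrt n%:R < `|partial_sum X n w|) ->
  (1 <= limsup_norm_sum X w)%E.
Proof.
move=> t0 h; apply/lee_addgt0Pr => e e0.
suff : (((1 - e)%:E)%R <= limsup_norm_sum X w)%E.
  by rewrite EFinB leeBlDr.
apply: limn_esup_ge => N.
pose L := Num.max (- ln theta / e) 0.
have [M _ HM] := ln_ln_large (L + 1).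
have [n Nn Sn] := h (maxn (maxn N M) 1%N).
move: Nn; rewrite !geq_max => /andP[/andP[Nn Mn] n1].
exists n => //; rewrite lee_fin.
have Ln : L + 1 <= ln (ln n%:R) by exact: HM.
have L0 : 0 <= L by rewrite le_max lexx orbT.
have ll0 : 0 < ln (ln n%:R) :> R by lra.
have q0 : 0 < Num.sqrt n%:R :> R by rewrite sqrtr_gt0 ltr0n.
have tS : theta < `|partial_sum X n w / Num.sqrt n%:R|.
  by rewrite normrM normfV (gtr0_norm q0) ltr_pdivlMr.
apply: (@le_trans _ _ (theta `^ (ln (ln n%:R))^-1)); last first.
  by rewrite ge0_ler_powR ?nnegrE ?invr_ge0 ?ltW// (lt_trans t0).
rewrite /powR gt_eqF//.
apply: (@le_trans _ _ (1 + (ln (ln n%:R))^-1 * ln theta)); last exact: expR_ge1Dx.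
rewrite lerD2l lerNl -mulrN mulrC ler_pdivrMr//.
have : - ln theta / e <= L by rewrite le_max lexx.
rewrite ler_pdivrMr// => h1; apply: (le_trans h1).
by rewrite mulrC ler_wpM2l ?ltW//; lra.
Qed.

(** Indeed [expR delta = (L `^ delta) `^ (ln L)^-1]; with [L = ln n] this turns
    bounds on the normalised sums into powers of the logarithm. *)
Lemma powR_inv_lnln_le (x delta L : R) : 0 <= x -> 0 < delta -> 0 < ln L ->
  (x `^ (ln L)^-1 <= expR delta) = (x <= L `^ delta).
Proof.
move=> x0 d0 L0.
have Lpos : 0 < L by rewrite ltNge; apply/negP => /ln0 h; rewrite h ltxx in L0.
have E : expR delta = (L `^ delta) `^ (ln L)^-1.
  rewrite -powRrM /powR gt_eqF//; congr expR.
  by rewrite -mulrA mulVf ?mulr1// gt_eqF.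
rewrite E; apply/idP/idP => [|h]; last first.
  by rewrite ge0_ler_powR ?nnegrE ?invr_ge0 ?powR_ge0// ltW.
rewrite leNgt => h; rewrite leNgt; apply/negP => h'; move/negP: h; apply.
by rewrite gt0_ltr_powR ?nnegrE ?invr_gt0 ?powR_ge0.
Qed.

Lemma limsup_norm_sum_le1P w : (limsup_norm_sum X w <= 1)%E <->
  forall delta : R, 0 < delta -> \forall n \near \oo,
    `|partial_sum X n w| <= Num.sqrt n%:R * (ln n%:R) `^ delta.
Proof.
have E (delta : R) : 0 < delta -> \forall n \near \oo,
  (`|partial_sum X n w| <= Num.sqrt n%:R * (ln n%:R) `^ delta) =
  ((`|partial_sum X n w / Num.sqrt n%:R| `^ (ln (ln n%:R))^-1) <= expR delta).
  move=> d0; near=> n.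
  have q0 : 0 < Num.sqrt n%:R :> R.
    by rewrite sqrtr_gt0 ltr0n; near: n; exists 1%N.
  rewrite powR_inv_lnln_le//; last by near: n; exact: ln_ln_pos.
  by rewrite normrM normfV (gtr0_norm q0) ler_pdivrMr// mulrC.
split=> [le1 delta d0|h].
  have lt1 : (limsup_norm_sum X w < (expR delta)%:E)%E.
    by rewrite (le_lt_trans le1)// lte_fin -expR0 ltr_expR.
  have [_ [V [N _ NV] <-] sV] := ereal_inf_lt lt1.
  near=> n; rewrite (near (E _ d0) n)//.
  rewrite -lee_fin (le_trans _ (ltW sV))//; apply: ereal_sup_ubound.
  by exists n => //; apply: NV; near: n; exists N.
apply/lee_addgt0Pr => e e0.
have d0 : 0 < ln (1 + e) by rewrite ln_gt0// ltrDl.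
rewrite -EFinD -(@lnK _ (1 + e)) ?posrE ?addr_gt0//.
apply: limn_esup_le; near=> n.
rewrite lee_fin -(near (E _ d0) n)//; near: n; exact: h.
Unshelve. all: by end_near. Qed.

End NormalizedLimsup.

(** * Truncation and the logarithmic moment *)

Section LogMoment.
Context (R : realType).
Implicit Types x y b c : R.

Lemma sqr_powR x b : (x `^ b) ^+ 2 = x `^ (2 * b).
Proof. by rewrite -powR_mulrn ?powR_ge0// -powRrM mulrC. Qed.

Lemma Llog_ge1 x : 1 <= Llog x.
Proof.
rewrite /Llog -[leLHS]expRK ler_ln ?posrE ?expR_gt0//.
  by rewrite le_max lexx.
by rewrite lt_max expR_gt0.
Qed.

Lemma Llog_gt0 x : 0 < Llog x.
Proof. exact: lt_le_trans (Llog_ge1 x). Qed.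

Lemma Llog_le x y : x <= y -> Llog x <= Llog y.
Proof.
move=> xy; rewrite /Llog ler_ln ?posrE ?lt_max ?expR_gt0//.
by rewrite ge_max le_max lexx/= le_max xy orbT.
Qed.

Lemma Llog_id x : expR 1 <= x -> Llog x = ln x.
Proof. by move=> ex; rewrite /Llog max_r. Qed.

Lemma Llog_le_id x : 1 <= x -> Llog x <= x.
Proof.
move=> x1; rewrite /Llog; case: (leP (expR 1) x) => [ex|_].
  by apply/ltW/ln_sublinear; exact: lt_le_trans x1.
by rewrite expRK.
Qed.

Lemma Llog_ge_half_ln x y : 1 <= x -> x <= y ^+ 2 -> 0 <= y -> ln x / 2 <= Llog y.
Proof.
move=> x1 xy y0; have y1 : 0 < y.
  rewrite lt_neqAle y0 andbT; apply/negP => /eqP y0'.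
  by move: xy; rewrite -y0' expr0n/=; lra.
have : ln x <= ln y *+ 2.
  by rewrite -lnXn// ler_ln ?posrE ?exprn_gt0//; exact: lt_le_trans x1.
have : ln y <= Llog y.
  by rewrite /Llog ler_ln ?posrE ?lt_max ?expR_gt0// le_max lexx orbT.
by rewrite mulr2n; lra.
Qed.

(** From [Llog (u * c) <= ln u + Llog c <= u - 1 + Llog c], for [u >= 1]. *)
Lemma Llog_scale c x : 0 < c -> c <= x -> Llog x <= Llog c * (x / c).
Proof.
move=> c0 cx; set u := x / c.
have u1 : 1 <= u by rewrite ler_pdivlMr// mul1r.
have u0 : 0 < u by exact: lt_le_trans u1.
have xE : x = u * c by rewrite /u divfK// gt_eqF.
have m0 : 0 < Num.max (expR 1) c by rewrite lt_max expR_gt0.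
have em : expR 1 <= Num.max (expR 1) c by rewrite le_max lexx.
have cm : c <= Num.max (expR 1) c by rewrite le_max lexx orbT.
apply: (@le_trans _ _ (ln (u * Num.max (expR 1) c))).
  have um : 0 < u * Num.max (expR 1) c by exact: mulr_gt0.
  rewrite /Llog ler_ln ?posrE ?lt_max ?expR_gt0//.
  rewrite ge_max; apply/andP; split.
    by rewrite (le_trans em)// ler_peMl// ltW.
  by rewrite xE ler_wpM2l// ltW.
rewrite lnM ?posrE//.
have := Llog_ge1 c; rewrite /Llog => Lc1.
have : ln u <= u - 1.
  by have := expR_ge1Dx (ln u); rewrite lnK ?posrE//; lra.
by move: u1; nra.
Qed.

Definition phi b x : R := x ^+ 2 / Llog `|x| `^ (2 * b).

Lemma phi_ge0 b x : 0 <= phi b x.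
Proof. by rewrite divr_ge0 ?sqr_ge0 ?powR_ge0. Qed.

Lemma measurable_Llog : measurable_fun setT (@Llog R).
Proof.
rewrite (_ : @Llog R = (@ln R) \o (fun x => Num.max (expR 1) x)) //.
apply: measurableT_comp; first exact: measurable_ln.
exact: measurable_maxr.
Qed.

Lemma measurable_phi b : measurable_fun setT (phi b).
Proof.
rewrite (_ : phi b = (fun x => x ^+ 2 * (Llog `|x|) `^ (- (2 * b)))); last first.
  by apply/funext => x; rewrite /phi powRN.
apply: measurable_funM; first exact: measurable_funX.
apply: (measurableT_comp (measurable_powR _)).
exact: (measurableT_comp measurable_Llog).
Qed.

Lemma norm_le_phi b x : 0 <= b -> b <= 1 / 2 -> `|x| <= 1 + phi b x.
Proof.
move=> b0 b1; have [x1|x1] := leP `|x| 1; first by rewrite (le_trans x1)// lerDl phi_ge0.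
suff : `|x| <= phi b x by lra.
rewrite ler_pdivlMr ?powR_gt0 ?Llog_gt0// -(real_normK (num_real x)) expr2.
have b21 : 2 * b <= 1 by lra.
by rewrite ler_wpM2l// (le_trans (ler1_powR (Llog_ge1 _) b21))// Llog_le_id// ltW.
Qed.

(** The events [phi b X <= n] and [|X| <= sqrt n * (ln n)^b] are comparable, as
    [ln |x|] and [ln n] are of the same order when [x^2] is about [n]; this lemma
    and the next give the two directions. *)
Lemma phi_le_norm b x n : 0 <= b -> b <= 1 / 2 -> expR 1 <= n -> phi b x <= n ->
  `|x| <= Num.sqrt n * ln n `^ b.
Proof.
move=> b0 b1 en; set y := `|x|.
have y0 : 0 <= y by exact: normr_ge0.
have n1 : 1 <= n.
  by rewrite (le_trans _ en)// -expR0 ler_expR.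
rewrite /phi -(real_normK (num_real x)) -/y ler_pdivrMr ?powR_gt0 ?Llog_gt0// => h.
have yn : y <= n.
  (* for b <= 1/2 the denominator of phi is at most y, so phi b x >= y *)
  rewrite leNgt; apply/negP => ny.
  have y1 : 1 <= y by rewrite (le_trans n1)// ltW.
  have : Llog y `^ (2 * b) <= y.
    have b21 : 2 * b <= 1 by lra.
    by rewrite (le_trans (ler1_powR (Llog_ge1 _) b21))// Llog_le_id.
  by move: h; rewrite expr2; nra.
have Lyn : Llog y `^ (2 * b) <= ln n `^ (2 * b).
  rewrite ge0_ler_powR ?nnegrE ?mulr_ge0 ?(ltW (Llog_gt0 _)) ?ln_ge0//.
  by rewrite -(Llog_id en) Llog_le.
have : y ^+ 2 <= (Num.sqrt n * ln n `^ b) ^+ 2.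
  rewrite exprMn sqr_sqrtr ?(le_trans ler01)// sqr_powR; apply: (le_trans h).
  by rewrite ler_wpM2l// (le_trans ler01).
by rewrite ler_sqr ?nnegrE ?mulr_ge0 ?sqrtr_ge0 ?powR_ge0.
Qed.

Lemma phi_gt_norm b x n : 0 <= b -> 1 <= n -> n < phi b x ->
  Num.sqrt n * (ln n / 2) `^ b < `|x|.
Proof.
move=> b0 n1; set y := `|x|.
have y0 : 0 <= y by exact: normr_ge0.
have n0 : 0 <= n by rewrite (le_trans ler01).
rewrite /phi -(real_normK (num_real x)) -/y ltr_pdivlMr ?powR_gt0 ?Llog_gt0// => h.
have ny : n <= y ^+ 2.
  rewrite (le_trans _ (ltW h))// ler_peMr//.
  by rewrite -[leLHS](powRr0 (Llog y)) ler_powR ?Llog_ge1// mulr_ge0.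
have Lyn : (ln n / 2) `^ (2 * b) <= Llog y `^ (2 * b).
  rewrite ge0_ler_powR ?nnegrE ?mulr_ge0 ?(ltW (Llog_gt0 _)) ?divr_ge0 ?ln_ge0//.
  exact: Llog_ge_half_ln.
have : (Num.sqrt n * (ln n / 2) `^ b) ^+ 2 < y ^+ 2.
  rewrite exprMn sqr_sqrtr// sqr_powR; apply: le_lt_trans h.
  by rewrite ler_wpM2l.
by rewrite ltr_sqr ?nnegrE ?mulr_ge0 ?sqrtr_ge0 ?powR_ge0.
Qed.

Definition truncate c x : R := if `|x| <= c then x else 0.

Lemma measurable_truncate c : measurable_fun setT (truncate c).
Proof.
apply: measurable_fun_ifT => //.
by apply: measurable_fun_ler => //; exact: normr_measurable.
Qed.

Lemma truncate_le c x : 0 <= c -> `|truncate c x| <= c.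
Proof. by move=> c0; rewrite /truncate; case: ifP => //; rewrite normr0. Qed.

Lemma truncate_sqr_le b c x : 0 <= b ->
  truncate c x ^+ 2 <= Llog c `^ (2 * b) * phi b x.
Proof.
move=> b0; rewrite /truncate; case: ifPn => [xc|_]; last first.
  by rewrite expr0n/= mulr_ge0 ?powR_ge0 ?phi_ge0.
rewrite /phi mulrCA ler_peMr ?sqr_ge0// ler_pdivlMr ?powR_gt0 ?Llog_gt0// mul1r.
by rewrite ge0_ler_powR ?nnegrE ?mulr_ge0 ?(ltW (Llog_gt0 _))// Llog_le.
Qed.

(** Beyond [c] the ratio [Llog y `^ (2 * b) / y] is at most its value at [c]. *)
Lemma truncate_dist_le b c x : 0 <= b -> b <= 1 / 2 -> 0 < c ->
  `|x - truncate c x| <= Llog c `^ (2 * b) / c * phi b x.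
Proof.
move=> b0 b1 c0; rewrite /truncate; case: ifPn => [xc|].
  by rewrite subrr normr0 mulr_ge0 ?phi_ge0// divr_ge0 ?powR_ge0 ?ltW.
rewrite -ltNge subr0 => cx; set y := `|x|.
have y0 : 0 < y by exact: lt_trans cx.
have L0 z : 0 < Llog z `^ (2 * b) by rewrite powR_gt0 ?Llog_gt0.
rewrite /phi -(real_normK (num_real x)) -/y.
have : Llog y `^ (2 * b) <= Llog c `^ (2 * b) * (y / c).
  have yc1 : 1 <= y / c by rewrite ler_pdivlMr// mul1r ltW.
  apply: (@le_trans _ _ ((Llog c * (y / c)) `^ (2 * b))).
    have yc0 : 0 <= y / c by rewrite (le_trans ler01).
    apply: ge0_ler_powR.
    - by rewrite mulr_ge0.
    - by rewrite nnegrE ltW// Llog_gt0.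
    - by rewrite nnegrE mulr_ge0// ltW// Llog_gt0.
    - by apply: Llog_scale => //; exact: ltW.
  rewrite powRM ?(ltW (Llog_gt0 _)) ?(le_trans ler01 yc1)//.
  rewrite ler_wpM2l ?powR_ge0//.
  have b21 : 2 * b <= 1 by lra.
  by rewrite ler1_powR.
move=> h; rewrite mulrA ler_pdivlMr//.
rewrite (_ : _ / c * _ = y * (Llog c `^ (2 * b) * (y / c))); last by ring.
by apply: ler_wpM2l; [exact: (ltW y0)|exact: h].
Qed.

(** From [expR (- y) >= 1 - y] and [1 / (1 - y) <= 1 + y + 2 y^2]. *)
Lemma expR_le_quadratic y : `|y| <= 1 / 2 -> expR y <= 1 + y + 2 * y ^+ 2.
Proof.
move=> /ler_normlP[y1 y2].
have h : 1 - y <= expR (- y) by exact: expR_ge1Dx.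
have e0 : 0 < expR y by exact: expR_gt0.
have : expR y * (1 - y) <= 1.
  by rewrite -[leRHS](expRxMexpNx_1 y) ler_wpM2l// ltW.
move=> h1; rewrite -(@ler_pM2r _ (1 - y)); last by lra.
by rewrite (le_trans h1)//; nra.
Qed.

(** The scale [2 * c] keeps the exponent below [1 / 2]; the truncation error and
    the quadratic term then each cost half of the last summand. The linear term
    is left untruncated so that it integrates to the mean. *)
Lemma expR_truncate_le b c x (e : R) : 0 <= b -> b <= 1 / 2 -> 0 < c -> `|e| = 1 ->
  expR (e * (2 * c)^-1 * truncate c x) <=
  1 + e * (2 * c)^-1 * x + Llog c `^ (2 * b) / c ^+ 2 * phi b x.
Proof.
move=> b0 b1 c0 e1; set L := Llog c `^ (2 * b); set t := truncate c x.
have t1 : `|e * (2 * c)^-1 * t| <= 1 / 2.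
  have k0 : 0 < (2 * c)^-1 by rewrite invr_gt0 mulr_gt0.
  have -> : `|e * (2 * c)^-1 * t| = (2 * c)^-1 * `|t|.
    by rewrite !normrM e1 mul1r (gtr0_norm k0).
  rewrite ler_pdivrMl ?mulr_gt0//.
  have := truncate_le x (ltW c0); rewrite -/t; lra.
apply: (le_trans (expR_le_quadratic t1)).
have e2 : e ^+ 2 = 1 by rewrite -(real_normK (num_real e)) e1 expr1n.
have h1 : 2 * (e * (2 * c)^-1 * t) ^+ 2 <= L / c ^+ 2 * phi b x / 2.
  have -> : 2 * (e * (2 * c)^-1 * t) ^+ 2 = e ^+ 2 * (t ^+ 2 * (c ^+ 2)^-1 / 2).
    by field; rewrite gt_eqF.
  rewrite e2 mul1r (_ : L / c ^+ 2 * phi b x / 2 = L * phi b x * (c ^+ 2)^-1 / 2).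
    have i2 : 0 <= (c ^+ 2)^-1 by rewrite invr_ge0 sqr_ge0.
    apply: ler_wpM2r; first by rewrite invr_ge0.
    by apply: ler_wpM2r => //; exact: truncate_sqr_le.
  by ring.
have h2 : e * (2 * c)^-1 * t - e * (2 * c)^-1 * x <= L / c ^+ 2 * phi b x / 2.
  rewrite -mulrBr (le_trans (ler_norm _))// !normrM e1 mul1r distrC.
  have k0 : 0 < (2 * c)^-1 by rewrite invr_gt0 mulr_gt0.
  rewrite (gtr0_norm k0).
  have := truncate_dist_le x b0 b1 c0; rewrite -/L -/t => h.
  have -> : L / c ^+ 2 * phi b x / 2 = (2 * c)^-1 * (L / c * phi b x).
    by field; rewrite gt_eqF.
  by rewrite ler_wpM2l// invr_ge0 mulr_ge0// ltW.
by lra.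
Qed.

End LogMoment.

(** * Tail sums and the growth of single summands *)

Section TailSums.
Context d (T : measurableType d) (R : realType) (P : probability T R).

Lemma sum_indicators_le (z : R) (m : nat) : 0 <= z ->
  \sum_(0 <= n < m) (((n%:R < z)%R)%:R : R) <= z + 1.
Proof.
move=> z0.
have cnt k : \sum_(0 <= n < k) (((n%:R < z)%R)%:R : R) <= k%:R.
  apply: (@le_trans _ _ (\sum_(0 <= n < k) 1)).
    by apply: ler_sum => n _; rewrite lern1 leq_b1.
  by rewrite sumr_const_nat subn0.
elim: m => [|m IH]; first by rewrite big_geq// addr_ge0.
have [mz|zm] := ltP m%:R z.
  by rewrite (le_trans (cnt _))// -natr1 lerD2r ltW.
by rewrite big_nat_recr//= ltNge zm/= addr0.
Qed.

Lemma sum_indicators_ge (z : R) : 0 <= z ->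
  z <= \sum_(0 <= n < (Num.truncn z).+1) (((n%:R < z)%R)%:R : R).
Proof.
move=> z0; set m := Num.truncn z.
have mz : m%:R <= z by rewrite truncn_le.
rewrite big_nat_recr//= (eq_big_nat _ _ (F2 := fun=> 1)); last first.
  move=> n /andP[_ nm]; rewrite (_ : n%:R < z)//.
  by rewrite (lt_le_trans _ mz)// ltr_nat.
rewrite sumr_const_nat subn0.
have [mz'|zm] := ltP m%:R z; last by rewrite addr0.
by rewrite natr1 ltW// truncnS_gt.
Qed.

Let above (Z : T -> R) (n : nat) (w : T) : \bar R := (((n%:R < Z w)%R)%:R)%:E.

Let aboveE (Z : T -> R) (n : nat) :
  above Z n = EFin \o (\1_[set w | n%:R < Z w] : T -> R).
Proof.
apply/funext => w; rewrite /above /= indicE; congr (_%:R%:E); congr nat_of_bool.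
by apply/idP/idP; rewrite inE.
Qed.

Let measurable_above (Z : T -> R) (n : nat) : measurable_fun setT Z ->
  measurable_fun setT (above Z n).
Proof.
move=> mZ; rewrite aboveE; apply/measurable_EFinP.
by apply: measurable_indic; exact: measurable_gt_level.
Qed.

Let measurable_sum_above (Z : T -> R) : measurable_fun setT Z ->
  measurable_fun setT (fun w => \sum_(n <oo) above Z n w)%E.
Proof.
move=> mZ.
apply: (@ge0_emeasurable_sum _ _ _ setT (fun n w => above Z n w) xpredT).
  by move=> n w _ _; rewrite lee_fin.
by move=> n _; exact: measurable_above.
Qed.

Let tail_sumE (Z : T -> R) : measurable_fun setT Z ->
  (\sum_(n <oo) P [set w | (n%:R < Z w)%R] =
   \int[P]_w (\sum_(n <oo) above Z n w))%E.
Proof.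
move=> mZ; rewrite integral_nneseries//.
- apply: eq_eseriesr => n _; rewrite aboveE.
  by rewrite integral_indic// ?setIT//; exact: measurable_gt_level.
- by move=> n; exact: measurable_above.
- by move=> n w _; rewrite lee_fin.
Qed.

(** The sum of the indicators of [Z > n] counts the integers in [0, Z), a number
    between [Z] and [Z + 1]. *)
Lemma tail_sum_le (Z : T -> R) : measurable_fun setT Z -> (forall w, 0 <= Z w) ->
  (\sum_(n <oo) P [set w | (n%:R < Z w)%R] <= \int[P]_w (Z w)%:E + 1)%E.
Proof.
move=> mZ Z0; rewrite tail_sumE//.
have mEZ : measurable_fun setT (EFin \o Z) by exact/measurable_EFinP.
rewrite -[X in (_ + X)%E](_ : (\int[P]_w (cst 1%E w) = 1)%E); last first.
  by rewrite integral_cst// mul1e [LHS]probability_setT.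
rewrite -ge0_integralD//; last by move=> w _; rewrite lee_fin.
apply: ge0_le_integral => //.
- by move=> w _; apply: nneseries_ge0 => n _ _; rewrite lee_fin.
- exact: measurable_sum_above.
- exact: emeasurable_funD.
- move=> w _; apply: lime_le; first by apply: is_cvg_nneseries => n _ _; rewrite lee_fin.
  apply: nearW => m; rewrite sumEFin -EFinD lee_fin.
  exact: sum_indicators_le.
Qed.

Lemma tail_sum_ge (Z : T -> R) : measurable_fun setT Z -> (forall w, 0 <= Z w) ->
  (\int[P]_w (Z w)%:E <= \sum_(n <oo) P [set w | (n%:R < Z w)%R])%E.
Proof.
move=> mZ Z0; rewrite tail_sumE//.
apply: ge0_le_integral => //.
- by move=> w _; rewrite lee_fin.
- exact/measurable_EFinP.
- exact: measurable_sum_above.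
- move=> w _; apply: (@le_trans _ _
     (\sum_(0 <= n < (Num.truncn (Z w)).+1) (((n%:R < Z w)%R)%:R)%:E)%E).
    by rewrite sumEFin lee_fin; exact: sum_indicators_ge.
  by apply: nneseries_lim_ge => n _ _; rewrite lee_fin.
Qed.

Lemma ln_powR_dominates (K g e : R) : g < e ->
  \forall n \near \oo, K * ln n%:R `^ g <= ln n%:R `^ e :> R.
Proof.
move=> ge; near=> n.
have l1 : 0 < ln (ln n%:R) :> R by near: n; exact: ln_ln_pos.
have l0 : 0 < ln n%:R :> R.
  by rewrite ltNge; apply/negP => /ln0 h; move: l1; rewrite h ltxx.
rewrite -[e in leRHS](subrK g) powRD; last by rewrite (gt_eqF l0) implybT.
rewrite ler_wpM2r ?powR_ge0//.
have [K0|K0] := leP K 0; first by rewrite (le_trans K0)// powR_ge0.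
rewrite -[leLHS]lnK ?posrE// /powR gt_eqF// ler_expR.
rewrite -ler_pdivrMl ?subr_gt0//.
by near: n; exact: ln_ln_large.
Unshelve. all: by end_near. Qed.

(** The bound is written so that its partial sums telescope. *)
Lemma borel_cantelli_inv_square (A : nat -> set T) (K : R) :
  (forall k, measurable (A k)) ->
  (\forall k \near \oo, (P (A k) <= (K / (k.+1%:R * k.+2%:R))%:E)%E) ->
  {ae P, forall w, \forall k \near \oo, ~ A k w}.
Proof.
move=> mA [k0 _ hK].
pose B k := if (k0 <= k)%N then A k else set0.
have mB k : measurable (B k) by rewrite /B; case: ifP.
have K0 : 0 <= K.
  have := le_trans (measure_ge0 P (A k0)) (hK k0 (leqnn k0)).
  by rewrite lee_fin pmulr_lge0// invr_gt0 mulr_gt0.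
have PB k : (P (B k) <= (K / (k.+1%:R * k.+2%:R))%:E)%E.
  rewrite /B; case: ifP => [/hK//|_].
  by rewrite measure0 lee_fin divr_ge0// mulr_ge0.
have tel m : \sum_(0 <= k < m) (K / (k.+1%:R * k.+2%:R)) = K - K / m.+1%:R.
  elim: m => [|m IH]; first by rewrite big_geq// divr1 subrr.
  rewrite big_nat_recr//= IH -!natr1.
  have m0 : 0 <= m%:R :> R by [].
  by field; do ?[split]; rewrite gt_eqF// -?natrD ?ltr_wpDl// ; lra.
have sB : (\sum_(k <oo) P (B k) < +oo)%E.
  apply: (@le_lt_trans _ _ K%:E); last exact: ltry.
  apply: lime_le; first by apply: is_cvg_nneseries => k _ _; exact: measure_ge0.
  apply: nearW => m.
  apply: (@le_trans _ _ (\sum_(0 <= k < m) (K / (k.+1%:R * k.+2%:R))%:E)%E).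
    by apply: lee_sum => k _; exact: PB.
  by rewrite sumEFin lee_fin tel gerBl divr_ge0.
have := borel_cantelli_first mB sB.
apply: filterS => w [N _ hN]; exists (maxn N k0) => // k /=.
rewrite geq_max => /andP[Nk kk].
by have := hN k Nk; rewrite /B kk.
Qed.

Variable X : nat -> {RV P >-> R}.
Hypothesis iidX : iid X.

Let measurable_gt_phi (b x : R) : measurable [set y : R | x < phi b y].
Proof.
by apply: measurable_gt_level; exact: measurable_phi.
Qed.

Lemma phi_moment_bound (b : R) : 0 <= b -> b <= 1 / 2 ->
  (\int[P]_w (phi b (X 0%N w))%:E < +oo)%E ->
  {ae P, forall w, \forall n \near \oo, `|X n w| <= Num.sqrt n%:R * ln n%:R `^ b}.
Proof.
move=> b0 b1 fin.
have mphi : measurable_fun setT (phi b \o X 0%N).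
  exact: (measurableT_comp (@measurable_phi R b)).
pose A n := X n @^-1` [set y | n%:R < phi b y].
have mA n : measurable (A n).
  by rewrite -[X in measurable X]setTI; apply: measurable_funP.
have sA : (\sum_(n <oo) P (A n) < +oo)%E.
  rewrite (eq_eseriesr
    (g := fun n => P [set w | (n%:R < phi b (X 0%N w))%R])); last first.
    by move=> n _; exact: (prob_ident iidX).
  apply: le_lt_trans (tail_sum_le mphi _) _; first by move=> w; exact: phi_ge0.
  by rewrite lte_add_pinfty// ltry.
have := borel_cantelli_first mA sA; apply: filterS => w hw; near=> n.
apply: phi_le_norm => //; first by near: n; exact: nbhs_infty_ger.
by rewrite leNgt; apply/negP; near: n.
Unshelve. all: by end_near. Qed.

(** If the moment were infinite, the second Borel-Cantelli lemma would give
    infinitely many [n] with [phi b (X n) > n]; the loss from [b] to [delta]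
    absorbs the constant [K]. *)
Lemma phi_moment_of_growth (b delta K : R) : 0 <= delta -> delta < b -> 0 < K ->
  {ae P, forall w, \forall n \near \oo,
     `|X n w| <= K * (Num.sqrt n%:R * ln n%:R `^ delta)} ->
  (\int[P]_w (phi b (X 0%N w))%:E < +oo)%E.
Proof.
move=> d0 db K0 grow.
have b0 : 0 <= b by rewrite (le_trans d0)// ltW.
have mphi : measurable_fun setT (phi b \o X 0%N).
  exact: (measurableT_comp (@measurable_phi R b)).
apply: le_lt_trans (tail_sum_ge mphi _) _; first by move=> w; exact: phi_ge0.
pose A n := X n @^-1` [set y | n%:R < phi b y].
have PA n : P [set w | n%:R < phi b (X 0%N w)] = P (A n).
  by apply/esym; exact: (prob_ident iidX).
rewrite (eq_eseriesr (g := fun n => P (A n))); last by move=> n _; exact: PA.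
rewrite ltey; apply/negP => /eqP sA.
have hA n : history X [set n] (A n) by exact: history_preimage.
have tD : trivIset setT (fun n : nat => [set n]).
  by apply/trivIsetP => i j _ _ ij; apply/seteqP; split=> // k /=;
    move=> [-> /eqP]; rewrite (negbTE ij).
have [indX _] := iidX.
have io := borel_cantelli_second indX tD hA sA.
have PT : (0 < P [set: T])%E by rewrite probability_setT.
have [w [io_w grow_w]] : exists w, (forall n, exists2 k, (n <= k)%N & A k w) /\
    \forall n \near \oo, `|X n w| <= K * (Num.sqrt n%:R * ln n%:R `^ delta).
  have PF := ae_properfilter_algebraOfSetsType PT.
  by have [w [h1 h2]] := @filter_ex _ _ PF _ (filterI io grow); exists w.
have large : \forall n \near \oo,
    K * (Num.sqrt n%:R * ln n%:R `^ delta) <= Num.sqrt n%:R * (ln n%:R / 2) `^ b :> R.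
  near=> n.
  have l1 : 0 < ln (ln n%:R) :> R by near: n; exact: ln_ln_pos.
  have l0 : 0 < ln n%:R :> R.
    by rewrite ltNge; apply/negP => /ln0 h; move: l1; rewrite h ltxx.
  rewrite mulrCA ler_wpM2l ?sqrtr_ge0// powRM ?invr_ge0 ?(ltW l0)//.
  rewrite -ler_pdivrMr ?powR_gt0 ?invr_gt0// mulrAC.
  by near: n; exact: ln_powR_dominates.
have [N _ HN] : \forall n \near \oo, ~ A n w.
  near=> n => An.
  have h1 : `|X n w| <= K * (Num.sqrt n%:R * ln n%:R `^ delta) by near: n.
  have h2 : K * (Num.sqrt n%:R * ln n%:R `^ delta) <=
      Num.sqrt n%:R * (ln n%:R / 2) `^ b :> R by near: n; exact: large.
  have n1 : 1 <= n%:R :> R by near: n; exact: nbhs_infty_ger.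
  have := phi_gt_norm b0 n1 An; rewrite ltNge => /negP; apply.
  exact: le_trans h2.
by have [k Nk Ak] := io_w N; exact: HN k Nk Ak.
Unshelve. all: by end_near. Qed.

End TailSums.

(** * The upper bound *)

Section GrowthBound.
Context d (T : measurableType d) (R : realType) (P : probability T R).
Variable X : nat -> {RV P >-> R}.
Hypothesis iidX : iid X.
Variables (b : R).
Hypotheses (b0 : 0 <= b) (b1 : b <= 1 / 2).
Let b21 : 2 * b <= 1. Proof. by move: b1; lra. Qed.
Hypothesis intX : P.-integrable setT (EFin \o X 0%N).
Hypothesis phi_fin : (\int[P]_w (phi b (X 0%N w))%:E < +oo)%E.

Let mu : R := \int[P]_w X 0%N w.
Let A : R := \int[P]_w phi b (X 0%N w).

Let A0 : 0 <= A. Proof. by apply: Rintegral_ge0 => w _; exact: phi_ge0. Qed.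

Let mphi : measurable_fun setT (phi b \o X 0%N).
Proof. exact: (measurableT_comp (@measurable_phi R b)). Qed.

Let intphi : P.-integrable setT (EFin \o (fun w => phi b (X 0%N w))).
Proof.
apply/integrableP; split; first exact/measurable_EFinP.
apply: le_lt_trans phi_fin; apply: ge0_le_integral => //.
- by apply: measurableT_comp => //; exact/measurable_EFinP.
- exact/measurable_EFinP.
- by move=> w _; rewrite /= ger0_norm// phi_ge0.
Qed.

Lemma Rintegral_expR_truncate_le (c q e : R) : 0 < c -> `|e| = 1 ->
  Llog c `^ (2 * b) / c ^+ 2 * A <= q ->
  \int[P]_w expR (e * (2 * c)^-1 * (truncate c (X 0%N w) - mu)) <= expR q.
Proof.
move=> c0 e1 hq; set k := e * (2 * c)^-1; set C := Llog c `^ (2 * b) / c ^+ 2.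
have mT : measurable_fun setT (fun w => expR (k * truncate c (X 0%N w))).
  apply: measurableT_comp; first exact: measurable_expR.
  apply: measurable_funM => //.
  exact: (measurableT_comp (@measurable_truncate R c)).
have iT : P.-integrable setT (EFin \o (fun w => expR (k * truncate c (X 0%N w)))).
  apply: (@bounded_integrable _ _ _ _ _ (expR (`|k| * c))) => // w.
  rewrite ger0_norm ?expR_ge0// ler_expR (le_trans (ler_norm _))// normrM.
  by rewrite ler_wpM2l// truncate_le// ltW.
have iX : P.-integrable setT (EFin \o (fun w => k * X 0%N w)).
  have -> : EFin \o (fun w => k * X 0%N w) = (fun w => k%:E * (X 0%N w)%:E)%E.
    by apply/funext => w /=; rewrite EFinM.
  exact: integrableZl.
have iC : P.-integrable setT (EFin \o (fun w => C * phi b (X 0%N w))).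
  have -> : EFin \o (fun w => C * phi b (X 0%N w)) =
      (fun w => C%:E * (phi b (X 0%N w))%:E)%E.
    by apply/funext => w /=; rewrite EFinM.
  exact: integrableZl.
have i1 : P.-integrable setT (EFin \o (fun=> 1 : R)).
  exact: finite_measure_integrable_cst.
have i1X : P.-integrable setT (EFin \o (fun w => 1 + k * X 0%N w)).
  exact: (integrableD measurableT i1 iX).
have iB : P.-integrable setT (EFin \o (fun w => 1 + k * X 0%N w + C * phi b (X 0%N w))).
  exact: (integrableD measurableT i1X iC).
under eq_Rintegral => w _ do rewrite mulrBr expRD.
rewrite RintegralZr//.
have : \int[P]_w expR (k * truncate c (X 0%N w)) <= 1 + k * mu + C * A.
  apply: (@le_trans _ _ (\int[P]_w (1 + k * X 0%N w + C * phi b (X 0%N w)))).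
    by apply: le_Rintegral => // w _; exact: expR_truncate_le.
  rewrite RintegralD// RintegralD// Rintegral_cst// !RintegralZl//.
  by rewrite [X in fine X]probability_setT mulr1.
move=> h; apply: (@le_trans _ _ (expR (k * mu + q) * expR (- (k * mu)))).
  rewrite ler_wpM2r ?expR_ge0// (le_trans h)// -addrA.
  by rewrite (le_trans _ (expR_ge1Dx _))// lerD2l lerD2l.
by rewrite -expRD addrAC subrr add0r.
Qed.

(** The size [sqrt n * (log n)^b] that single summands do not exceed, at
    [n = 2^k]. *)
Definition level (k : nat) : R := Num.sqrt (2 ^ k)%:R * k%:R `^ b.

Lemma level_gt0 k : (0 < k)%N -> 0 < level k.
Proof. by move=> k0; rewrite mulr_gt0 ?sqrtr_gt0 ?powR_gt0 ?ltr0n ?expn_gt0. Qed.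

Lemma sqr_level k : level k ^+ 2 = (2 ^ k)%:R * k%:R `^ (2 * b).
Proof. by rewrite /level exprMn sqr_sqrtr// sqr_powR. Qed.

Lemma Llog_level_le k : (0 < k)%N -> Llog (level k) <= k%:R.
Proof.
move=> k0; have k1 : 1 <= k%:R :> R by rewrite ler1n.
rewrite /Llog -[leRHS]expRK ler_ln ?posrE ?lt_max ?expR_gt0// ge_max ler_expR k1/=.
have e0 : 0 <= expR k%:R :> R by exact: expR_ge0.
rewrite -ler_sqr ?nnegrE ?(ltW (level_gt0 k0))// sqr_level [leRHS]expr2.
apply: ler_pM => //.
  rewrite -[X in expR X]mulr1 natrX expRM_natl lerXn2r ?nnegrE ?expR_ge0//.
  by have := expR_ge1Dx (1 : R); lra.
rewrite (le_trans (ler1_powR k1 b21))//.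
by have := expR_ge1Dx (k%:R : R); lra.
Qed.

Let h k (x : R) := truncate (level k) x - mu.

Let mh k : measurable_fun setT (h k).
Proof. by apply: measurable_funB => //; exact: measurable_truncate. Qed.

(** Chernoff's bound with parameter [1 / (2 * level k)]: as
    [Llog (level k) `^ (2 * b) / level k ^+ 2 <= 2^-k], the exponential moment of
    a sum of at most [2^k] terms is at most [expR A]. *)
Lemma block_sum_truncate_tail (g : R) k a n : (0 < k)%N -> (n <= 2 ^ k)%N ->
  (P [set w | (Num.sqrt (2 ^ k)%:R * k%:R `^ g < `|block_sum X (h k) a (a + n) w|)%R]
   <= (2 * expR (A - k%:R `^ (g - b) / 2))%:E)%E.
Proof.
move=> k0 nk; set t := Num.sqrt _ * _; set c := level k.
have c0 : 0 < c by exact: level_gt0.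
have p0 : 0 < (2 ^ k)%:R :> R by rewrite ltr0n expn_gt0.
pose q : R := A / (2 ^ k)%:R.
have hq : Llog c `^ (2 * b) / c ^+ 2 * A <= q.
  rewrite /q [leRHS]mulrC ler_wpM2r//.
  rewrite sqr_level ler_pdivrMr ?mulr_gt0 ?powR_gt0 ?ltr0n ?expn_gt0//.
  rewrite mulrA mulVf ?mul1r ?gt_eqF//.
  have Lk := Llog_level_le k0.
  by apply: ge0_ler_powR; rewrite ?nnegrE ?mulr_ge0 ?(ltW (Llog_gt0 _)).
have hb x : `|h k x| <= c + `|mu|.
  by rewrite (le_trans (ler_normB _ _))// lerD2r truncate_le// ltW.
have l0 : 0 <= (2 * c)^-1 by rewrite invr_ge0 mulr_ge0// ltW.
have q1 : \int[P]_w expR ((2 * c)^-1 * h k (X 0%N w)) <= expR q.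
  by have := Rintegral_expR_truncate_le c0 (normr1 _) hq; rewrite mul1r.
have q2 : \int[P]_w expR (- (2 * c)^-1 * h k (X 0%N w)) <= expR q.
  by have := Rintegral_expR_truncate_le c0 (normrN1 _) hq; rewrite mulN1r.
apply: (le_trans (chernoff_block_sum iidX t a n (@mh k) hb l0 q1 q2)).
rewrite lee_fin ler_pM2l// ler_expR lerD//.
  rewrite -mulr_natr /q -mulrA ler_piMr// mulrC ler_pdivrMr// mul1r ler_nat//.
rewrite lerN2 powRB; last by rewrite pnatr_eq0 -lt0n k0 implybT.
rewrite /c /t /level.
have kb0 : 0 < k%:R `^ b :> R by rewrite powR_gt0// ltr0n.
have s0 : 0 < Num.sqrt (2 ^ k)%:R :> R by rewrite sqrtr_gt0.
set s := Num.sqrt _ in s0 *; set u := _ `^ b in kb0 *; set v := _ `^ g.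
rewrite (_ : (2 * (s * u))^-1 * (s * v) = v / u / 2)//.
by field; rewrite !gt_eqF.
Qed.

(** In terms of [u = ln k], the quadratic lower bound for [expR (e * u)] beats
    any linear function of [u]. *)
Lemma powR_beats_ln (M e : R) : 0 < e ->
  \forall k \near \oo, M + 2 * ln k.+2%:R <= k%:R `^ e / 2 :> R.
Proof.
move=> e0; near=> k.
pose U : R := Num.max 1 (8 * (`|M| + 4) / e ^+ 2).
have kU : expR U <= k%:R by near: k; exact: nbhs_infty_ger.
have k2 : 2 <= k%:R :> R by near: k; exact: nbhs_infty_ger.
have k0 : 0 < k%:R :> R by rewrite (lt_le_trans _ k2).
set u := ln k%:R : R.
have uU : U <= u by rewrite -[leLHS]expRK ler_ln ?posrE ?expR_gt0.
have u1 : 1 <= u by rewrite (le_trans _ uU)// le_max lexx.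
have uM : 8 * (`|M| + 4) <= e ^+ 2 * u.
  rewrite -ler_pdivrMl ?exprn_gt0// mulrC (le_trans _ uU)// le_max lexx orbT//.
have l2 : ln k.+2%:R <= 2 * u.
  rewrite -[2 * u]mulrC mulr_natr -lnXn// ler_ln ?posrE ?exprn_gt0//.
  by rewrite -addn2 natrD; nra.
have ke : (e * u) ^+ 2 / 4 <= k%:R `^ e.
  rewrite /powR gt_eqF// -/u.
  rewrite (_ : e * u = 2%:R * (e * u / 2)); last by field.
  rewrite expRM_natl (_ : _ / 4 = (e * u / 2) ^+ 2); last by field.
  have y0 : 0 <= e * u / 2 by rewrite divr_ge0// mulr_ge0 ?(ltW e0)// (le_trans ler01).
  rewrite ler_sqr ?nnegrE ?expR_ge0//.
  by have := expR_ge1Dx (e * u / 2); lra.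
have u0 : 0 <= u by rewrite (le_trans ler01).
have uu : 8 * (`|M| + 4) * u <= (e * u) ^+ 2.
  by rewrite exprMn (expr2 u) mulrA ler_wpM2r.
have Mu : `|M| <= `|M| * u by rewrite ler_peMr.
by move: (ler_norm M) l2 ke uu Mu; lra.
Unshelve. all: by end_near. Qed.

(** Ottaviani's inequality turns the tail bound at the end of the [k]-th dyadic
    scale into a bound on the maximum over it; the resulting probabilities
    [expR (- k^(g - b) / 2)] are summable because [k] runs over dyadic scales
    only. *)
Lemma truncated_sums_bounded (g : R) : b < g ->
  {ae P, forall w, \forall k \near \oo, forall j, (j <= 2 ^ k)%N ->
    `|block_sum X (h k) 1 (1 + j) w| <= 2 * (Num.sqrt (2 ^ k)%:R * k%:R `^ g)}.
Proof.
move=> bg; pose t k : R := Num.sqrt (2 ^ k)%:R * k%:R `^ g.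
pose E k := [set w | exists2 j, (j <= 2 ^ k)%N &
    2 * t k < `|block_sum X (h k) 1 (1 + j) w|].
have mE k : measurable (E k).
  have -> : E k = \bigcup_(j in [set j | (j <= 2 ^ k)%N])
      [set w | 2 * t k < `|block_sum X (h k) 1 (1 + j) w|].
    by apply/seteqP; split=> w [j jk hj]; exists j.
  apply: bigcup_measurable => j _; apply: history_measurable; apply: adapted_gt.
  apply: (@adapted_comp _ _ _ _ _ _ _ (fun x => `|x|)); first exact: normr_measurable.
  exact: adapted_block_sum (mh k).
have small : \forall k \near \oo, (0 < k)%N /\
    expR (A - k%:R `^ (g - b) / 2) <= (k.+2%:R ^+ 2)^-1.
  near=> k; split; first by near: k; exists 1%N.
  have k2 : 0 < k.+2%:R :> R by [].
  rewrite -[leRHS]lnK ?posrE ?invr_gt0 ?exprn_gt0// ler_expR lnV ?posrE ?exprn_gt0//.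
  have : A + 2 * ln k.+2%:R <= k%:R `^ (g - b) / 2.
    by near: k; apply: powR_beats_ln; rewrite subr_gt0.
  by rewrite lnXn// mulr2n; lra.
have PE : \forall k \near \oo, (P (E k) <= (4 / (k.+1%:R * k.+2%:R))%:E)%E.
  near=> k.
  have [k0 sk] : (0 < k)%N /\ expR (A - k%:R `^ (g - b) / 2) <= (k.+2%:R ^+ 2)^-1.
    by near: k.
  have k1 : 1 <= k.+1%:R :> R by rewrite ler1n.
  have k12 : k.+2%:R = k.+1%:R + 1 :> R by rewrite -[in LHS]natr1.
  have tail a n := @block_sum_truncate_tail g k a n k0.
  have half j : (j <= 2 ^ k)%N ->
     (P [set w | (t k < `|block_sum X (h k) (1 + j) (1 + 2 ^ k) w|)%R] <= (2^-1)%:E)%E.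
    move=> jk; have := tail (1 + j)%N (2 ^ k - j)%N (leq_subr _ _).
    rewrite -addnA subnKC// => /le_trans; apply; rewrite lee_fin.
    have : (k.+2%:R ^+ 2)^-1 <= 4^-1 :> R.
      by rewrite lef_pV2 ?posrE ?exprn_gt0// k12; nra.
    move=> h4; have := le_trans sk h4; set z := expR _; lra.
  have [indX _] := iidX.
  have := ottaviani indX (mh k) half; rewrite -/(E k) => /le_trans; apply.
  apply: (@le_trans _ _ (2%:E * (2 * expR (A - k%:R `^ (g - b) / 2))%:E)%E).
    by apply: lee_wpmul2l; [rewrite lee_fin|exact: tail].
  rewrite -EFinM lee_fin.
  rewrite (_ : 2 * (2 * _) = 4 * expR (A - k%:R `^ (g - b) / 2)); last by ring.
  rewrite ler_pM2l//.
  rewrite (le_trans sk)// lef_pV2 ?posrE ?exprn_gt0 ?mulr_gt0// expr2.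
  by rewrite ler_wpM2r// ler_nat.
have := borel_cantelli_inv_square mE PE.
apply: filterS => w; apply: filterS => k nE j jk.
by rewrite leNgt; apply/negP => hj; apply: nE; exists j.
Unshelve. all: by end_near. Qed.

(** The finitely many exceptional summands are bounded by a random constant [B],
    which the growing levels exceed as well. *)
Lemma eventually_below_level w :
  (\forall n \near \oo, `|X n w| <= Num.sqrt n%:R * ln n%:R `^ b) ->
  \forall k \near \oo, forall i, (i <= 2 ^ k)%N -> `|X i w| <= level k.
Proof.
move=> [N _ HN]; pose B : R := \sum_(0 <= i < N) `|X i w|.
near=> k => i ik.
have k0 : (0 < k)%N by near: k; exists 1%N.
have k1 : 1 <= k%:R :> R by rewrite ler1n.
have kb1 : 1 <= k%:R `^ b :> R by rewrite -[leLHS](powRr0 k%:R) ler_powR.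
have [Ni|iN] := leqP N i; last first.
  apply: (@le_trans _ _ B).
    rewrite /B big_mkord (bigD1 (Ordinal iN))//= lerDl.
    by apply: sumr_ge0.
  have Bk : B ^+ 2 <= k%:R by near: k; exact: nbhs_infty_ger.
  have B0 : 0 <= B by apply: sumr_ge0.
  rewrite (@le_trans _ _ (Num.sqrt (2 ^ k)%:R))//; last by rewrite ler_peMr ?sqrtr_ge0.
  rewrite -[B]ger0_norm// -sqrtr_sqr ler_wsqrtr// (le_trans Bk)// ler_nat.
  exact/ltnW/ltn_expl.
apply: (le_trans (HN i Ni)).
have [i0|i0] := posnP i; first by rewrite i0 sqrtr0 mul0r ltW// level_gt0.
have i1 : 1 <= i%:R :> R by rewrite ler1n.
rewrite /level; apply: ler_pM; rewrite ?sqrtr_ge0 ?powR_ge0//.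
  by rewrite ler_wsqrtr// ler_nat.
apply: ge0_ler_powR; rewrite ?nnegrE ?ln_ge0//.
apply: (@le_trans _ _ (ln (2 ^ k)%:R)).
  by rewrite ler_ln ?posrE ?ltr0n ?expn_gt0// ler_nat.
have l2 : ln 2 <= 1 :> R.
  by rewrite -[leRHS]expRK ler_ln ?posrE ?expR_gt0//; have := expR_ge1Dx (1 : R); lra.
by rewrite natrX lnXn// -(mulr_natl (ln 2)) ler_piMr.
Unshelve. all: by end_near. Qed.

(** The exponent [g] between [b] and [delta] leaves room for the constants lost
    when [n] is compared with the next power of 2. *)
Lemma growth_bound (delta : R) : b < delta ->
  {ae P, forall w, \forall n \near \oo,
    `|partial_sum X n w - n%:R * mu| <= Num.sqrt n%:R * ln n%:R `^ delta}.
Proof.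
move=> bd; pose g := (b + delta) / 2.
have bg : b < g by move: bd; rewrite /g; lra.
have gd : g < delta by move: bd; rewrite /g; lra.
have g0 : 0 <= g by rewrite (le_trans b0)// ltW.
have aeS := truncated_sums_bounded bg.
have aeX := phi_moment_bound iidX b0 b1 phi_fin.
apply: filterS2 aeS aeX => w sums /eventually_below_level lev.
have [k0 _ Hk0] := filterI sums lev.
near=> n.
have n0 : (0 < n)%N by near: n; exists 1%N.
have nk0 : (2 ^ k0 <= n)%N by near: n; exists (2 ^ k0)%N.
pose k := (trunc_log 2 n).+1.
have kk0 : (k0 <= k)%N by rewrite /k leqW// trunc_log_max.
have nk : (n <= 2 ^ k)%N by rewrite ltnW// trunc_log_ltn.
have kn : (2 ^ k <= 2 * n)%N by rewrite /k expnS leq_mul2l trunc_logP.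
have [Hs Hl] := Hk0 k kk0.
have -> : partial_sum X n w - n%:R * mu = block_sum X (h k) 1 (1 + n) w.
  rewrite /partial_sum /block_sum /h sumrB add1n sumr_const_nat subn1/= mulr_natl.
  congr (_ - _); apply: eq_big_nat => i /andP[_ i1].
  by rewrite /truncate Hl// (leq_trans _ nk).
apply: (le_trans (Hs n nk)).
have L1 : 1 <= ln n%:R :> R.
  rewrite -[leLHS]expRK ler_ln ?posrE ?expR_gt0 ?ltr0n//.
  by near: n; exact: nbhs_infty_ger.
have kL : k%:R <= 3 * ln n%:R :> R.
  have : ln (2 ^ trunc_log 2 n)%:R <= ln n%:R :> R.
    by rewrite ler_ln ?posrE ?ltr0n ?expn_gt0// ler_nat trunc_logP.
  rewrite natrX lnXn// -(mulr_natl (ln 2)).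
  rewrite /k -natr1; set m := _%:R.
  have l2 : 2^-1 <= ln 2 :> R.
    rewrite -[leLHS]expRK ler_ln ?posrE ?expR_gt0//.
    have := expR_ge1Dx (- 2^-1 : R); rewrite expRN => h2.
    rewrite -[leLHS]invrK -[leRHS]invrK lef_pV2 ?posrE ?invr_gt0 ?expR_gt0//.
    lra.
  by move: l2 L1 (ler0n R (trunc_log 2 n)); rewrite -/m; nra.
have s2 : Num.sqrt (2 ^ k)%:R <= 2 * Num.sqrt n%:R :> R.
  have -> : 2 * Num.sqrt n%:R = Num.sqrt (2 ^+ 2 * n%:R) :> R.
    by rewrite sqrtrM// sqrtr_sqr ger0_norm.
  rewrite ler_wsqrtr// -natrX -natrM ler_nat (leq_trans kn)// leq_mul2r.
  by rewrite orbT.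
have kg : k%:R `^ g <= 3 `^ g * ln n%:R `^ g :> R.
  rewrite -powRM// ?(le_trans ler01)//.
  have L3 : 0 <= 3 * ln n%:R :> R by rewrite mulr_ge0// (le_trans ler01).
  by apply: ge0_ler_powR => //; rewrite nnegrE.
apply: (@le_trans _ _ (Num.sqrt n%:R * ((4 * 3 `^ g) * ln n%:R `^ g))).
  have := ler_pM (sqrtr_ge0 _) (powR_ge0 _ _) s2 kg; lra.
rewrite ler_wpM2l ?sqrtr_ge0//; near: n; exact: ln_powR_dominates.
Unshelve. all: by end_near. Qed.

End GrowthBound.

(** * The equivalence *)

Section Equivalence.
Context d (T : measurableType d) (R : realType) (P : probability T R).
Variable X : nat -> {RV P >-> R}.
Hypothesis iidX : iid X.

Let growth_le1 w : (forall m : nat, \forall n \near \oo,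
    `|partial_sum X n w| <= Num.sqrt n%:R * ln n%:R `^ (m.+1%:R^-1)) ->
  (limsup_norm_sum X w <= 1)%E.
Proof.
move=> h; apply/limsup_norm_sum_le1P => delta d0.
have [m _ md] := near_infty_natSinv_lt (PosNum d0).
near=> n; apply: (@le_trans _ _ (Num.sqrt n%:R * ln n%:R `^ (m.+1%:R^-1))).
  by near: n; exact: h.
rewrite ler_wpM2l ?sqrtr_ge0// ler_powR//; last exact/ltW/(md m)/leqnn.
have n1 : expR 1 <= n%:R :> R by near: n; exact: nbhs_infty_ger.
by rewrite -[leLHS]expRK ler_ln ?posrE ?expR_gt0// (lt_le_trans _ n1)// expR_gt0.
Unshelve. all: by end_near. Qed.

Lemma limsup_le1_of_moments :
  P.-integrable setT (EFin \o X 0%N) -> \int[P]_w X 0%N w = 0 ->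
  (forall e : R, 0 < e -> exists b : R, [/\ 0 < b, b < e &
    (\int[P]_w (phi b (X 0%N w))%:E < +oo)%E]) ->
  {ae P, forall w, (limsup_norm_sum X w <= 1)%E}.
Proof.
move=> intX EX0 mom.
have ae_m (m : nat) : {ae P, forall w, \forall n \near \oo,
    `|partial_sum X n w| <= Num.sqrt n%:R * ln n%:R `^ (m.+1%:R^-1)}.
  have e0 : 0 < Num.min (m.+1%:R^-1) (1 / 2) :> R by rewrite lt_min invr_gt0 ltr0n/=.
  have [b [b0 be fin]] := mom _ e0.
  move: be; rewrite lt_min => /andP[bm b1].
  have := growth_bound iidX (ltW b0) (ltW b1) intX fin bm.
  by apply: filterS => w; apply: filterS => n; rewrite EX0 mulr0 subr0.
by apply: filterS (ae_foralln ae_m) => w; exact: growth_le1.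
Qed.

Let increment_growth w (delta : R) : 0 < delta -> (limsup_norm_sum X w <= 1)%E ->
  \forall n \near \oo, `|X n w| <= 2 * (Num.sqrt n%:R * ln n%:R `^ delta).
Proof.
move=> d0 /limsup_norm_sum_le1P/(_ _ d0)[N _ HN].
near=> n; have n1 : (N.+1 < n)%N by near: n; exists N.+2.
have -> : X n w = partial_sum X n w - partial_sum X n.-1 w.
  have nE : n = n.-1.+1 by rewrite (ltn_predK n1).
  by rewrite nE /partial_sum /= big_nat_recr//= addrAC subrr add0r.
have Nn : (N <= n.-1)%N by rewrite -ltnS (ltn_predK n1) ltnW.
rewrite (le_trans (ler_normB _ _))// mulr_natl mulr2n lerD//.
  by apply: HN; rewrite /= (leq_trans Nn)// leq_pred.
apply: (le_trans (HN _ Nn)); apply: ler_pM; rewrite ?sqrtr_ge0 ?powR_ge0//.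
  by rewrite ler_wsqrtr// ler_nat leq_pred.
have p1 : (1 <= n.-1)%N by rewrite -ltnS (ltn_predK n1) (leq_trans _ n1).
apply: ge0_ler_powR; rewrite ?nnegrE ?ln_ge0 ?ler1n ?(ltW d0)//.
  by rewrite (leq_trans p1)// leq_pred.
by rewrite ler_ln ?posrE ?ltr0n ?ler_nat ?leq_pred// (leq_trans p1)// leq_pred.
Unshelve. all: by end_near. Qed.

(** The moments follow from the growth of the increments [X n] of the sums. The
    mean vanishes because [growth_bound] gives [S_n - n * mu = o(n)], while the
    hypothesis gives [S_n = o(n)]. *)
Lemma moments_of_limsup_le1 :
  {ae P, forall w, (limsup_norm_sum X w <= 1)%E} ->
  [/\ P.-integrable setT (EFin \o X 0%N), \int[P]_w X 0%N w = 0 &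
    forall b : R, 0 < b -> (\int[P]_w (phi b (X 0%N w))%:E < +oo)%E].
Proof.
move=> le1.
have fin b : 0 < b -> (\int[P]_w (phi b (X 0%N w))%:E < +oo)%E.
  move=> b0; have d0 : 0 < b / 2 by rewrite divr_gt0.
  have db : b / 2 < b by rewrite gtr_pMr// invf_lt1// ltr1n.
  apply: (phi_moment_of_growth iidX (ltW d0) db (ltr0n R 2)).
  by apply: filterS le1 => w; exact: increment_growth.
have q0 : 0 < 1 / 4 :> R by [].
have q2 : 1 / 4 <= 1 / 2 :> R by rewrite !div1r lef_pV2 ?posrE// ler_nat.
have q2' : 1 / 4 < 1 / 2 :> R by rewrite !div1r ltf_pV2 ?posrE// ltr_nat.
have mX : measurable_fun setT (X 0%N) by exact: measurable_funP.
have intX : P.-integrable setT (EFin \o X 0%N).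
  apply/integrableP; split; first exact/measurable_EFinP.
  apply: (@le_lt_trans _ _ (\int[P]_w (1 + (phi (1 / 4) (X 0%N w))%:E))%E).
    apply: ge0_le_integral => //.
    - by apply: measurableT_comp => //; exact/measurable_EFinP.
    - apply: emeasurable_funD => //; apply/measurable_EFinP.
      exact: (measurableT_comp (@measurable_phi R (1 / 4))).
    - by move=> w _; rewrite lee_fin norm_le_phi// ltW.
  rewrite ge0_integralD//.
  - rewrite lte_add_pinfty// ?fin//.
    by rewrite integral_cst// mul1e [X in (X < _)%E]probability_setT ltry.
  - by move=> w _; rewrite lee_fin phi_ge0.
  - apply/measurable_EFinP.
    exact: (measurableT_comp (@measurable_phi R (1 / 4))).
split=> //.
set mu := \int[P]_w X 0%N w.
have PT : (0 < P [set: T])%E by rewrite probability_setT.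
have PF := ae_properfilter_algebraOfSetsType PT.
have [w [le_w gr_w]] := @filter_ex _ _ PF _
  (filterI le1 (growth_bound iidX (ltW q0) q2 intX (fin _ q0) q2')).
have h0 : 0 < 1 / 2 :> R by [].
have S_w := (limsup_norm_sum_le1P X w).1 le_w _ h0.
rewrite -/mu in gr_w.
apply/eqP/negPn/negP => mu0.
have m2 : 0 < mu ^+ 2 by rewrite exprn_even_gt0.
(* mu^2 * n <= 4 * ln n <= 8 * sqrt n contradicts this choice of n *)
have [n [n1 hn gn sn]] : exists n, [/\ (1 <= n)%N, 8 / mu ^+ 2 < Num.sqrt n%:R :> R,
    `|partial_sum X n w - n%:R * mu| <= Num.sqrt n%:R * ln n%:R `^ (1 / 2) &
    `|partial_sum X n w| <= Num.sqrt n%:R * ln n%:R `^ (1 / 2)].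
  have : \forall n \near \oo, [/\ (1 <= n)%N, 8 / mu ^+ 2 < Num.sqrt n%:R :> R,
    `|partial_sum X n w - n%:R * mu| <= Num.sqrt n%:R * ln n%:R `^ (1 / 2) &
    `|partial_sum X n w| <= Num.sqrt n%:R * ln n%:R `^ (1 / 2)].
    near=> n; split; first by near: n; exists 1%N.
    - have h : (8 / mu ^+ 2) ^+ 2 < n%:R by near: n; exact: nbhs_infty_gtr.
      have h8 : 0 <= 8 / mu ^+ 2 by rewrite divr_ge0 ?sqr_ge0.
      rewrite -[ltLHS](ger0_norm h8) -sqrtr_sqr ltr_sqrt//.
      by rewrite (le_lt_trans _ h)// sqr_ge0.
    - by near: n; exact: gr_w.
    - by near: n; exact: S_w.
  by move=> [N _ HN]; exists N; apply: HN => /=.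
have nr : 1 <= n%:R :> R by rewrite ler1n.
set s := Num.sqrt n%:R in hn gn sn; set l := ln n%:R `^ (1 / 2) in gn sn.
have s0 : 0 < s by rewrite sqrtr_gt0 (lt_le_trans _ nr).
have ss : s ^+ 2 = n%:R by rewrite sqr_sqrtr// (le_trans ler01).
have l0 : 0 <= l by exact: powR_ge0.
have ll : l ^+ 2 = ln n%:R.
  by rewrite sqr_powR mulrC divfK// powRr1// ln_ge0.
have lns : ln n%:R <= 2 * s.
  rewrite -ss lnXn// -(mulr_natl (ln s)) ler_wpM2l//.
  by apply/ltW/ln_sublinear.
have nm : n%:R * `|mu| <= 2 * (s * l).
  rewrite -[n%:R]ger0_norm// -normrM.
  rewrite (_ : n%:R * mu = partial_sum X n w - (partial_sum X n w - n%:R * mu)).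
    by apply: (le_trans (ler_normB _ _)); move: gn sn; lra.
  by rewrite opprB addrC subrK.
have sm : s * `|mu| <= 2 * l.
  by rewrite -(@ler_pM2l _ s)// mulrA -expr2 ss [leRHS]mulrCA.
have : (s * `|mu|) ^+ 2 <= (2 * l) ^+ 2.
  by rewrite ler_sqr ?nnegrE ?mulr_ge0// ltW.
rewrite !exprMn ll real_normK ?num_real// => h.
move: hn; rewrite ltr_pdivrMr//; apply/negP; rewrite -leNgt.
rewrite -(@ler_pM2l _ s)// mulrA -expr2 (le_trans h)//.
by move: lns; lra.
Unshelve. all: by end_near. Qed.

End Equivalence.

Theorem theorem2p2 (d : measure_display) (T : measurableType d) (R : realType)
    (P : probability T R) (X : nat -> {RV P >-> R})
    (iidX : iid X) (ndX : non_degenerate (X 0%N)) :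
  let limsup_le1 := {ae P, forall w, (limsup_norm_sum X w <= 1)%E} in
  let moment_cond :=
    (P.-integrable [set: T] (EFin \o X 0%N) /\ ('E_P[X 0%N] = 0)%E) /\
    ereal_inf [set b%:E | b in [set b : R | 0 < b /\
      ('E_P[fun w => (X 0%N w ^+ 2 / Llog `|X 0%N w| `^ (2 * b))%R] < +oo)%E]]
    = 0%E in
  (limsup_le1 <-> moment_cond) /\
  (limsup_le1 \/ moment_cond ->
    {ae P, forall w, limsup_norm_sum X w = 1%E}).
Proof.
move=> limsup_le1 moment_cond.
have phiE b : ('E_P[fun w => (X 0%N w ^+ 2 / Llog `|X 0%N w| `^ (2 * b))%R] =
    \int[P]_w (phi b (X 0%N w))%:E)%E by rewrite unlock.
have EXE : P.-integrable [set: T] (EFin \o X 0%N) ->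
    ('E_P[X 0%N] = (\int[P]_w X 0%N w)%:E)%E.
  by move=> intX; rewrite unlock /Rintegral fineK//; exact: integrable_fin_num.
have eqv : limsup_le1 <-> moment_cond.
  split=> [le1|[[intX EX0] inf0]].
    have [intX EX0 fin] := moments_of_limsup_le1 iidX le1.
    split; first by rewrite EXE// EX0.
    apply/eqP; rewrite eq_le; apply/andP; split.
      apply/lee_addgt0Pr => e e0; rewrite add0e; apply: ereal_inf_lbound.
      by exists e => //; split=> //; rewrite phiE; exact: fin.
    by apply: le_ereal_inf_tmp => _ [b [b0 _] <-]; rewrite lee_fin ltW.
  apply: limsup_le1_of_moments => //.
    by move: EX0; rewrite EXE// => -[].
  move=> e; rewrite -lte_fin -[X in (X < _)%E]inf0.
  move=> /ereal_inf_lt[_ [b [b0 bfin] <-]]; rewrite lte_fin => be.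
  by exists b; split=> //; rewrite -phiE.
split=> // le1_or.
have le1 : limsup_le1 by case: le1_or => // /eqv.
have [theta [theta0 large]] := partial_sum_frequently_large iidX ndX.
apply: filterS2 le1 large => w le1_w large_w.
by apply/eqP; rewrite eq_le le1_w/=; exact: limsup_norm_sum_ge1 large_w.
Qed.
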